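(* Let $r>0$ and let $\psi,k,g,F,\gamma$ satisfy the following assumptions. (1) $\psi:[-r,1]\to[0,+\infty)$ is continuously differentiable and $\psi(t)=\psi'(t)=0$ for all $t\in[0,1]$. (2) $k:[-r,1]\times[0,1]\to[0,+\infty)$ is measurable, $k(t,s)=0$ for all $t\in[-r,0]$ and a.e. $s\in[0,1]$, and for every $\bar t\in[0,1]$ we have $\lim_{t\to\bar t}|k(t,s)-k(\bar t,s)|=0$ for a.e. $s\in[0,1]$. (3) For a.e. $s\in[0,1]$, the partial derivative $\partial_t k(t,s)$ is continuous in $t\in[-r,1]$ except at the point $t=s$, where there can be a jump discontinuity (right and left limits both exist), and there exists $\Psi\in L^1(0,1)$ such that $|\partial_t k(t,s)|\le\Psi(s)$ for $t\in[0,1]$ and a.e. $s\in[0,1]$. (4) $g:[0,1]\to\mathbb{R}$ is measurable, $g(t)\ge 0$ for a.e. $t\in[0,1]$, $g\Psi\in L^1[0,1]$, and $\int_a^b\Psi(s)g(s)\,ds>0$ for some $0\le a<b\le 1$. (5) $F:[0,1]\times C^1([-r,0],\mathbb{R})\to[0,\infty)$ is such that $t\mapsto F(t,\phi)$ is measurable for each $\phi$, $\phi\mapsto F(t,\phi)$ is continuous for a.e. $t$, and for each $R>0$ there exists $\varphi_R\in L^\infty[0,1]$ such that $F(t,\phi)\le\varphi_R(t)$ for all $\phi\in C^1([-r,0],\mathbb{R})$ with $\|\phi\|_{[-r,0],1}\le R$ and a.e. $t\in[0,1]$. (6) $\gamma:[-r,1]\to[0,\infty)$ is continuously differentiable and $\gamma(t)=\gamma'(t)=0$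 for all $t\in[-r,0]$. Let $\rho\in(0,+\infty)$ and assume moreover that: (a) there exists $\underline{\delta}_\rho\in C([0,1],[0,\infty))$ such that $F(t,u_t)\ge\underline{\delta}_\rho(t)$ for every $t\in[0,1]$ and every $u\in\partial K_{\psi,\rho}$; (b) $B:\overline{K}_{\psi,\rho}\to[0,\infty)$ is continuous and bounded, and $\underline{\eta}_\rho\in[0,+\infty)$ is such that $B[u]\ge\underline{\eta}_\rho$ for every $u\in\partial K_{\psi,\rho}$; (c) the inequality $$\sup_{t\in[0,1]}\Bigl\{\gamma(t)\underline{\eta}_\rho+\int_0^1 k(t,s)g(s)\underline{\delta}_\rho(s)\,ds\Bigr\}>0$$ holds. Then there exist $\lambda_\rho\in(0,+\infty)$ and $u_\rho\in\partial K_{\psi,\rho}$ such that $$u_\rho(t)=\psi(t)+\lambda_\rho\Bigl(\int_0^1 k(t,s)g(s)F(s,(u_\rho)_s)\,ds+\gamma(t)B[u_\rho]\Bigr)\quad\text{for all } t\in[-r,1].$$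
   Context: For a compact interval $I\subset\mathbb{R}$, $C^1(I,\mathbb{R})$ is the Banach space of continuously differentiable functions on $I$ with norm $\|u\|_{I,1}:=\max\{\|u\|_{I,\infty},\|u'\|_{I,\infty}\}$, where $\|u\|_{I,\infty}:=\sup_{t\in I}|u(t)|$. For a continuous function $u:J\to\mathbb{R}$ on a real interval $J$ and $t$ with $[t-r,t]\subseteq J$, $u_t:[-r,0]\to\mathbb{R}$ denotes the function $u_t(\theta)=u(t+\theta)$. In $C^1([-r,1],\mathbb{R})$ define the cone $$K_0=\{u\in C^1([-r,1],\mathbb{R}): u(t)\ge0\text{ for every }t\in[-r,1],\ u(t)=u'(t)=0\text{ for every }t\in[-r,0]\},$$ its translate $K_\psi=\psi+K_0$, and the sets $K_{0,\rho}=\{u\in K_0:\|u\|_{[0,1],1}<\rho\}$ and $K_{\psi,\rho}=\psi+K_{0,\rho}$. $\overline{K}_{\psi,\rho}$ and $\partial K_{\psi,\rho}$ denote the closure and the boundary of $K_{\psi,\rho}$ relative to $K_\psi$.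
   Formalization: Assumption (3) is strengthened: for a.e. s, k(·,s) itself is required to be continuous on [-r,1], so only its derivative may jump at t=s; otherwise k(t,s)=1 for 0≤s≤t (0 else), with g=F=1, B=ψ=γ=0, is a counterexample. *)

(* Defs.v *)
From HB Require Import structures.
From mathcomp Require Import all_boot all_order all_algebra.
From mathcomp Require Import all_classical all_reals all_analysis.
Set Implicit Arguments.
Unset Strict Implicit.
Unset Printing Implicit Defensive.
Import Order.TTheory GRing.Theory Num.Theory.
Import numFieldNormedType.Exports.
Local Open Scope classical_set_scope.
Local Open Scope ring_scope.

Section derivative_on_interval.
Context {R : realType}.
Implicit Types (a b t : R) (f : R -> R).

Definition diffquot f t (s : R) : R := (f s - f t) / (s - t).

(* At an endpoint of [a, b] these are the one-sided notions. *)
Definition derivable_itv a b f t : Prop :=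
  cvg (diffquot f t @ within `[a, b] t^').

(* When [a, b] is degenerate the limit is taken along an improper filter and
   is arbitrary; the value 0 makes [derive_itv a b] linear in all cases. *)
Definition derive_itv a b f t : R :=
  if a < b then lim (diffquot f t @ within `[a, b] t^') else 0.

Definition is_C1 a b f : Prop :=
  (forall t, t \in `[a, b] -> derivable_itv a b f t) /\
  {within `[a, b], continuous (derive_itv a b f)}.

(* [f] is continuous on [a, b], and C^1 there except that [f'] may have a jump
   at [c]. Continuity of [f] at [c] itself does not follow from the other
   clauses: they would also allow a jump of [f]. *)
Definition C1_but_jump a b c f : Prop :=
  [/\ {within `[a, b], continuous f},
      forall t, t \in `[a, b] -> t != c -> derivable_itv a b f t,
      forall t, t \in `[a, b] -> t != c ->
        derive_itv a b f u @[u --> within `[a, b] (nbhs t)]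
          --> derive_itv a b f t,
      cvg (derive_itv a b f u @[u --> c^'-]) &
      cvg (derive_itv a b f u @[u --> c^'+])].

Definition supnorm a b f : R := sup [set `|f t| | t in `[a, b]].

Definition C1norm a b f : R :=
  Num.max (supnorm a b f) (supnorm a b (derive_itv a b f)).

Lemma within_dnbhs_proper a b t : a < b -> t \in `[a, b] ->
  ProperFilter (within `[a, b] t^').
Proof.
move=> ab /[!in_itv]/= /andP[at_ tb].
apply: Build_ProperFilter_ex => P.
rewrite /within/= /dnbhs/= => -[/= e e0 Pe].
have [tltb|] := ltP t b.
- pose s := Num.min b (t + e / 2).
  have ts : t < s by rewrite lt_min tltb ltrDl divr_gt0.
  exists s; apply: Pe => /=; last 2 first.
  + by rewrite gt_eqF.
  + by rewrite in_itv/= ge_min lexx/= (le_trans at_ (ltW ts)).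
  rewrite ltr0_norm ?subr_lt0// opprB ltrBlDl gt_min.
  by apply/orP; right; rewrite ltrD2l ltr_pdivrMr// ltr_pMr// ltr1n.
- move=> bt; have {}bt : t = b by apply/eqP; rewrite eq_le tb bt.
  pose s := Num.max a (t - e / 2).
  have st : s < t by rewrite gt_max bt ab/= -bt ltrBlDr ltrDl divr_gt0.
  exists s; apply: Pe => /=; last 2 first.
  + by rewrite lt_eqF.
  + by rewrite in_itv/= le_max lexx/= -bt (ltW st).
  rewrite gtr0_norm ?subr_gt0// ltrBlDr -ltrBlDl lt_max.
  by apply/orP; right; rewrite ltrD2l ltrN2 ltr_pdivrMr// ltr_pMr// ltr1n.
Qed.

Lemma diffquot_lin f g (k : R) t :
  diffquot (k *: f + g) t = k *: diffquot f t + diffquot g t.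
Proof.
apply/funext => s; rewrite /diffquot /= !fctE.
by rewrite -[k *: f s]/(k * f s) -[k *: f t]/(k * f t)
  -[k *: (_ / _)]/(k * _) mulrA -mulrDl mulrBr opprD addrACA.
Qed.

Lemma derivable_lin a b f g (k : R) t :
  derivable_itv a b f t -> derivable_itv a b g t ->
  derivable_itv a b (k *: f + g) t.
Proof.
move=> df dg; rewrite /derivable_itv diffquot_lin.
by apply: is_cvgD => //; exact: is_cvgZr.
Qed.

Lemma derive_lin a b f g (k : R) t : t \in `[a, b] ->
  derivable_itv a b f t -> derivable_itv a b g t ->
  derive_itv a b (k *: f + g) t = k * derive_itv a b f t + derive_itv a b g t.
Proof.
move=> tab df dg; rewrite /derive_itv diffquot_lin.
case: ifPn => ab; last by rewrite mulr0 addr0.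
have ? := within_dnbhs_proper ab tab.
apply/cvg_lim => //; apply: cvgD => //; exact: cvgZr.
Qed.

Lemma derivable_continuous a b f t : derivable_itv a b f t ->
  f @ within `[a, b] (nbhs t) --> f t.
Proof.
move=> df.
have H : f s @[s --> within `[a, b] t^'] --> f t.
  have -> : f t = 0 * lim (diffquot f t @ within `[a, b] t^') + f t.
    by rewrite mul0r add0r.
  apply: (@cvg_trans _
     ((fun s => (s - t) * diffquot f t s + f t) @ within `[a, b] t^')).
    apply: near_eq_cvg.
    have : \forall s \near t^', s != t by exact: nbhs_dnbhs_neq.
    apply: filterS => s st _; rewrite /diffquot mulrC divfK ?subrK//.
    by rewrite subr_eq0.
  apply: cvgD; last exact: cvg_cst.
  apply: cvgM => //.
  rewrite -(subrr t); apply: cvgB; last exact: cvg_cst.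
  by apply: cvg_within_filter; apply: cvg_within_filter; exact: cvg_id.
move=> P fP.
have H' : nbhs t (fun s => s != t -> s \in `[a, b] -> P (f s)) := H P fP.
suff : nbhs t (fun s => s \in `[a, b] -> P (f s)) by [].
near=> s => sab; have [->|st] := eqVneq s t; first exact: nbhs_singleton fP.
by move: st sab; near: s.
Unshelve. all: by end_near. Qed.

Lemma is_C1_continuous a b f : is_C1 a b f -> {within `[a, b], continuous f}.
Proof.
move=> [df _]; apply/subspace_continuousP => t tab.
exact/derivable_continuous/df.
Qed.

Lemma is_C1_ext a b f g : {in `[a, b], f =1 g} -> is_C1 a b f -> is_C1 a b g.
Proof.
move=> fg [df cf].
have sub (f1 f2 : R -> R) t P : {in `[a, b], f1 =1 f2} -> t \in `[a, b] ->
    (diffquot f1 t @ within `[a, b] t^') P ->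
    (diffquot f2 t @ within `[a, b] t^') P.
  move=> f12 tab fP.
  have {}fP : t^' (fun s => s \in `[a, b] -> P (diffquot f1 t s)) := fP.
  suff : t^' (fun s => s \in `[a, b] -> P (diffquot f2 t s)) by [].
  apply: filterS fP => s fP sab.
  by have := fP sab; rewrite /diffquot f12// f12.
have E t : t \in `[a, b] ->
    diffquot g t @ within `[a, b] t^' = diffquot f t @ within `[a, b] t^'.
  move=> tab; apply/seteqP; split => P; apply: sub => // s sab.
  by rewrite fg.
split=> [t tab|]; first by rewrite /derivable_itv E//; exact: df.
apply: subspace_eq_continuous cf => t /set_mem tab.
by rewrite /from_subspace /derive_itv E.
Qed.

Lemma has_ubound_abs a b f : {within `[a, b], continuous f} ->
  has_ubound [set `|f t| | t in `[a, b]].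
Proof.
move=> cf.
have [M [_ HM]] := compact_bounded (continuous_compact cf (@segment_compact _ _ _)).
exists (M + 1) => _ [t tab <-]; apply: (HM (M + 1)); last by exists t.
by rewrite ltrDl.
Qed.

Lemma supnorm_ge a b f t : {within `[a, b], continuous f} -> t \in `[a, b] ->
  `|f t| <= supnorm a b f.
Proof. by move=> cf tab; apply/ub_le_sup; [exact: has_ubound_abs | exists t]. Qed.

Lemma supnorm_ge0 a b f : 0 <= supnorm a b f.
Proof.
rewrite /supnorm; have [hs|hs] := pselect (has_sup [set `|f t| | t in `[a, b]]).
  have [[x [t tab _]] _] := hs; have [_ ub] := hs.
  by rewrite (le_trans (normr_ge0 (f t)))//; apply: ub_le_sup => //; exists t.
by rewrite sup_out.
Qed.

Lemma supnorm_le a b f (M : R) : 0 <= M ->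
  (forall t, t \in `[a, b] -> `|f t| <= M) -> supnorm a b f <= M.
Proof.
move=> M0 H; rewrite /supnorm; set E := [set _ | _ in _].
have [E0|/set0P E0] := eqVneq E set0; first by rewrite E0 sup0.
by apply: ge_sup => // _ [t tab <-]; exact: H.
Qed.

End derivative_on_interval.

(* C^1([a, b], R). A function on [a, b] is represented by its extension by 0 to
   the whole line, so that equality in this type is equality on [a, b]; the
   derivative used in [is_C1] and [C1norm] only sees the values on [a, b]. *)
Section C1_space.
Context {R : realType}.
Variables a b : R.

Definition C1_pred : {pred R -> R} := mem [set f : R -> R |
  is_C1 a b f /\ forall t, t \notin `[a, b] -> f t = 0].

Record C1 := MkC1 { C1_fun :> R -> R ; _ : C1_fun \in C1_pred }.

HB.instance Definition _ := [isSub for C1_fun].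
HB.instance Definition _ := [Choice of C1 by <:].

Lemma C1_submod_closed : submod_closed C1_pred.
Proof.
have lin (k : R) (f g : R -> R) : is_C1 a b f -> is_C1 a b g ->
    is_C1 a b (k *: f + g).
  move=> [df cf] [dg cg]; split => [t tab|].
    by apply: derivable_lin; [exact: df|exact: dg].
  have : {within `[a, b],
      continuous (k \*: derive_itv a b f \+ derive_itv a b g)}.
    move=> t; apply: cvgD; last exact: cg.
    by apply: cvgZr; exact: cf.
  apply: subspace_eq_continuous => t /set_mem tab /=.
  by rewrite /from_subspace /= derive_lin//; [exact: df|exact: dg].
split.
  apply/mem_set; split => //.
  have dq0 t : diffquot (0 : R -> R) t = cst 0.
    by apply/funext => s; rewrite /diffquot /= subrr mul0r.
  split=> [t tab|]; first by rewrite /derivable_itv dq0; exact: is_cvg_cst.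
  have /subspace_eq_continuous : {in `[a, b]%classic,
      (cst 0 : R -> R) =1 derive_itv a b 0}.
    move=> t /set_mem/= tab; rewrite /derive_itv dq0; case: ifPn => // ab.
    by have ? := within_dnbhs_proper ab tab; rewrite lim_cst.
  by apply; move=> x; exact: cvg_cst.
move=> k f g /set_mem[Cf f0] /set_mem[Cg g0]; apply/mem_set; split.
  exact: lin.
by move=> t tab; rewrite !fctE f0// g0// scaler0 addr0.
Qed.

HB.instance Definition _ := GRing.isSubmodClosed.Build R (R -> R) C1_pred
  C1_submod_closed.
HB.instance Definition _ := [SubChoice_isSubLmodule of C1 by <:].

Lemma C1P (u : C1) : is_C1 a b u.
Proof. by have /set_mem[] := valP u. Qed.

Lemma C1_out (u : C1) t : t \notin `[a, b] -> u t = 0.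
Proof. by have /set_mem[_] := valP u; apply. Qed.

Lemma C1_normD (u v : C1) :
  C1norm a b (u + v) <= C1norm a b u + C1norm a b v.
Proof.
have [du cdu] := C1P u; have [dv cdv] := C1P v.
have cu := is_C1_continuous (C1P u); have cv := is_C1_continuous (C1P v).
have D t : t \in `[a, b] -> derive_itv a b (u + v) t =
    derive_itv a b u t + derive_itv a b v t.
  move=> tab; have := derive_lin 1 tab (du t tab) (dv t tab).
  by rewrite scale1r mul1r.
have M0 : 0 <= C1norm a b u + C1norm a b v.
  by rewrite addr_ge0// le_max supnorm_ge0.
rewrite {1}/C1norm ge_max; apply/andP; split; apply: supnorm_le => // t tab.
  rewrite (le_trans (ler_normD _ _))// lerD// le_max.
    by rewrite (supnorm_ge cu tab).
  by rewrite (supnorm_ge cv tab).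
rewrite D// (le_trans (ler_normD _ _))// lerD// le_max.
  by rewrite (supnorm_ge cdu tab) orbT.
by rewrite (supnorm_ge cdv tab) orbT.
Qed.

Lemma C1_normZ (k : R) (u : C1) : C1norm a b (k *: u) = `|k| * C1norm a b u.
Proof.
have le (l : R) (v : C1) : C1norm a b (l *: v) <= `|l| * C1norm a b v.
  have [dv cdv] := C1P v; have cv := is_C1_continuous (C1P v).
  have [d0 _] := C1P 0.
  have D t : t \in `[a, b] -> derive_itv a b (l *: v) t = l * derive_itv a b v t.
    move=> tab; have := derive_lin l tab (dv t tab) (d0 t tab).
    have := derive_lin 1 tab (d0 t tab) (d0 t tab).
    rewrite scale1r addr0 mul1r => /eqP; rewrite -subr_eq0 opprD addNKr.
    by rewrite oppr_eq0 => /eqP ->; rewrite !addr0.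
  have M0 : 0 <= `|l| * C1norm a b v by rewrite mulr_ge0// le_max supnorm_ge0.
  rewrite {1}/C1norm ge_max; apply/andP; split; apply: supnorm_le => // t tab.
    by rewrite /= normrM ler_wpM2l// le_max (supnorm_ge cv tab).
  by rewrite D// normrM ler_wpM2l// le_max (supnorm_ge cdv tab) orbT.
apply/eqP; rewrite eq_le le /=.
have [->|k0] := eqVneq k 0.
  by rewrite normr0 mul0r le_max supnorm_ge0.
rewrite -ler_pdivlMl ?normr_gt0// -normfV.
by have := le k^-1 (k *: u); rewrite scalerA mulVf// scale1r.
Qed.

Lemma C1_norm0_eq0 (u : C1) : C1norm a b u = 0 -> u = 0.
Proof.
move=> u0; apply/val_inj/funext => t /=.
have [tab|tab] := boolP (t \in `[a, b]); last by rewrite C1_out.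
apply/eqP; rewrite -normr_le0 -u0 le_max.
by rewrite (supnorm_ge (is_C1_continuous (C1P u)) tab).
Qed.

HB.instance Definition _ := @Lmodule_isNormed.Build R C1
  (fun u : C1 => C1norm a b u) C1_normD C1_normZ C1_norm0_eq0.

Lemma C1_normE (u : C1) : `|u| = C1norm a b u.
Proof. by []. Qed.

(* The element of C^1([a, b], R) given by the restriction of [f] to [a, b]
   (0 when that restriction is not C^1). *)
Definition toC1 (f : R -> R) : C1 :=
  insubd 0 (fun t => if t \in `[a, b] then f t else 0).

Lemma toC1E f t : is_C1 a b f -> t \in `[a, b] -> toC1 f t = f t.
Proof.
move=> Cf tab; rewrite /toC1.
have Cf0 : (fun t => if t \in `[a, b] then f t else 0) \in C1_pred.
  apply/mem_set; split; last by move=> s /negbTE ->.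
  by apply: is_C1_ext Cf => s sab; rewrite sab.
by have := insubdK (0 : C1) Cf0 => /= ->; rewrite tab.
Qed.

End C1_space.

Section history.
Context {R : realType}.

Lemma cvg_shift_dnbhs (a b c d t x : R) :
  (forall s, s \in `[a, b] -> t + s \in `[c, d]) ->
  (fun s => t + s) @ within `[a, b] x^' --> within `[c, d] (t + x)^'.
Proof.
move=> sub P [/= e e0 Pe]; exists e => //= s xs sx sab.
apply: Pe => /=; last exact: sub.
  by rewrite opprD addrACA subrr add0r.
by rewrite (inj_eq (addrI t)).
Qed.

Lemma derive_shift (a b c d t : R) (f : R -> R) x : a < b ->
  (forall s, s \in `[a, b] -> t + s \in `[c, d]) ->
  x \in `[a, b] -> derivable_itv c d f (t + x) ->
  derivable_itv a b (fun s => f (t + s)) x /\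
  derive_itv a b (fun s => f (t + s)) x = derive_itv c d f (t + x).
Proof.
move=> ab sub xab df.
have E : diffquot (fun s => f (t + s)) x =
         diffquot f (t + x) \o (fun s => t + s).
  by apply/funext => s; rewrite /diffquot /= opprD addrACA subrr add0r.
have C : diffquot (fun s => f (t + s)) x @ within `[a, b] x^' -->
         lim (diffquot f (t + x) @ within `[c, d] (t + x)^').
  by rewrite E; apply: (cvg_comp _ _ (cvg_shift_dnbhs sub) df).
split; first by apply/cvg_ex; eexists; exact: C.
have cd : c < d.
  have := sub a; have := sub b; rewrite !in_itv/= !lexx (ltW ab).
  move=> /(_ isT)/andP[_ bd] /(_ isT)/andP[ca _].
  by rewrite (le_lt_trans ca)// (lt_le_trans _ bd)// ltrD2l.
rewrite /derive_itv ab cd.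
by have ? := within_dnbhs_proper ab xab; exact/cvg_lim.
Qed.

Lemma is_C1_shift (a b c d t : R) (f : R -> R) : a < b ->
  (forall s, s \in `[a, b] -> t + s \in `[c, d]) ->
  is_C1 c d f -> is_C1 a b (fun s => f (t + s)).
Proof.
move=> ab sub [df cf]; have ds x xab := derive_shift ab sub xab (df _ (sub x xab)).
split=> [x xab|]; first exact: (ds x xab).1.
apply/subspace_continuousP => x xab.
have /subspace_continuousP/(_ _ (sub x xab)) cfx := cf.
rewrite [X in _ --> X](ds x xab).2 => P /cfx.
rewrite /= => -[/= e e0 Pe]; exists e => //= s xs sab.
suff : P (derive_itv a b (fun s => f (t + s)) s) by [].
rewrite (ds s sab).2; apply: Pe; last exact: sub.
by rewrite /= opprD addrACA subrr add0r.
Qed.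

(* u_t, for u in C^1([-r, 1], R) *)
Definition hist (r : R) (u : C1 (- r) 1) (t : R) : C1 (- r) 0 :=
  toC1 (- r) 0 (fun theta => u (t + theta)).

Lemma histE r (u : C1 (- r) 1) t theta : 0 < r ->
  t \in `[0, 1] -> theta \in `[- r, 0] -> hist u t theta = u (t + theta).
Proof.
move=> r0 /[!in_itv]/= /andP[t0 t1] th; apply: toC1E => //.
apply: is_C1_shift (C1P u); first by rewrite oppr_lt0.
move=> s /[!in_itv]/= /andP[s0 s1]; apply/andP; split.
  by rewrite (le_trans s0)// lerDr.
by rewrite (le_trans _ t1)// gerDl.
Qed.

End history.

(* Closure and boundary of a subset [A] of [K], relative to [K]. *)
Definition rel_closure {T : topologicalType} (K A : set T) : set T :=
  closure (A : set (subspace K)).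

Definition rel_boundary {T : topologicalType} (K A : set T) : set T :=
  closure (A : set (subspace K)) `\` (A : set (subspace K))^°.

Section cone.
Context {R : realType} {r : R}.

Definition K0 : set (C1 (- r) 1) := [set u |
  (forall t, t \in `[- r, 1] -> 0 <= u t) /\
  (forall t, t \in `[- r, 0] -> u t = 0 /\ derive_itv (- r) 1 u t = 0)].

Definition K0_ball (rho : R) : set (C1 (- r) 1) :=
  [set u | K0 u /\ C1norm 0 1 u < rho].

Definition K_shift (psi : C1 (- r) 1) : set (C1 (- r) 1) := [set psi + u | u in K0].

Definition K_ball (psi : C1 (- r) 1) (rho : R) : set (C1 (- r) 1) :=
  [set psi + u | u in K0_ball rho].

Definition K_closure psi rho := rel_closure (K_shift psi) (K_ball psi rho).

Definition K_boundary psi rho := rel_boundary (K_shift psi) (K_ball psi rho).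

End cone.

(* "Measurable" refers to the sigma-algebras of Lebesgue measurable sets of the
   line and of the plane, not to the Borel ones. *)
Notation leb R := (@completed_lebesgue_measure R).

Section lebesgue_measurability.
Context {R : realType}.

Definition lebesgueTypeR := caratheodory_type (mu_ext (@wlength R idfun)).
HB.instance Definition _ := Measurable.on lebesgueTypeR.

Definition lebesgueTypeR2 := caratheodory_type
  (mu_ext (@lebesgue_measure R \x @lebesgue_measure R)%E).
HB.instance Definition _ := Measurable.on lebesgueTypeR2.

Definition leb_measurable (D : set R) (f : R -> R) : Prop :=
  @measurable_fun _ _ lebesgueTypeR R D f.

Definition leb2_measurable (D : set (R * R)) (f : R * R -> R) : Prop :=
  @measurable_fun _ _ lebesgueTypeR2 R D f.

Definition L1 (a b : R) (f : R -> R) : Prop :=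
  (leb R).-integrable `[a, b] (EFin \o f).

Definition Linfty (a b : R) (f : R -> R) : Prop :=
  leb_measurable `[a, b] f /\
  exists M : R, {ae leb R, forall t, t \in `[a, b] -> `|f t| <= M}.

End lebesgue_measurability.
Arguments lebesgueTypeR : clear implicits.
Arguments lebesgueTypeR2 : clear implicits.

(* Main.v *)
Require Import Defs.
From HB Require Import structures.
From mathcomp Require Import all_boot zify.

(** The equation reads [v = lambda * N v] for [v = u - psi] in the cone [K0],
    where [N v = int k g F(s, (psi + v)_s) ds + B (psi + v) gamma], and it has to
    be solved on the sphere [|v| = rho]. By (a), (b) and (c) there are a point
    [t0] and [e] in [K0] with [N v t0 >= e t0 > 0] on that sphere, so
    [W v = (|v| / rho) N (rho v / |v|) + (rho - |v|) e] does not come close to 0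
    on the ball of radius [rho] in [K0]. A fixed point of [v |-> rho W v / |W v|],
    given by Schauder's theorem, lies on the sphere, where [W = N].

    Compactness: the derivative of [t |-> int k(t, s) g(s) h(s) ds] has modulus of
    continuity [M int |dk/dt(t, s) - dk/dt(t', s)| g(s) ds] when [|h| <= M], whence
    an Ascoli argument. Schauder's theorem follows from Brouwer's theorem on a
    simplex, and that from a combinatorial lemma of Scarf, applied to the points of
    a grid ordered by each of their coordinates; its parity argument needs no
    triangulation (Petri and Voorneveld, No bullying! A playful proof of Brouwer's
    fixed-point theorem). *)

Set Implicit Arguments.
Unset Strict Implicit.
Unset Printing Implicit Defensive.

(** * Scarf's lemma *)

(** Two features of the hypotheses shape the proof. They bound [N] from below only on the sphere, so
    a map of the whole ball has to be built from its values there. Evaluation at [t0] is the tool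
    for this: it is linear and dominated by the norm, so the lower bound survives convex
    combinations, whereas norms of sums could cancel. Moreover, the assumptions on [k], on its
    derivative and on [F] hold outside null sets that depend on [t] or on the history. Such an
    uncountable family of null sets cannot be united, so each assumption is used along a countable
    dense set of parameters and extended by continuity. The jump of the derivative at [t = s] is
    harmless because, for fixed [t], it concerns a single [s]. Measurability is repaired in the same
    spirit: a Lebesgue measurable function on the plane has measurable sections for almost every [t]
    only, and the remaining [t] are reached as limits. *)

Section dominance.
Variables (T I : finType).

(** The condition behind Scarf's primitive sets: no point lies, in every order at once, strictly
    above the least element of [A]. *)
Definition dominant (r : I -> T -> nat) (A : {set T}) :=
  [forall y, exists i, forall x in A, r i y <= r i x].

Lemma dominantP (r : I -> T -> nat) (A : {set T}) :
  reflect (forall y, exists i, forall x, x \in A -> r i y <= r i x)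
    (dominant r A).
Proof.
apply: (iffP forallP) => H y; have := H y.
  by move=> /existsP[i /forall_inP Hi]; exists i.
by move=> [i Hi]; apply/existsP; exists i; apply/forall_inP.
Qed.

Lemma dominant_sub (r : I -> T -> nat) (A B : {set T}) :
  A \subset B -> dominant r B -> dominant r A.
Proof.
move=> /subsetP AB /dominantP HB; apply/dominantP => y.
by have [i Hi] := HB y; exists i => x /AB/Hi.
Qed.

(** Dominance applied to a point [x] of [A] itself gives an order in which [x] is least, and
    injectivity makes it [m i]. Hence a dominant set has at most as many points as there are
    orders. *)
Lemma dominant_min (r : I -> T -> nat) (A : {set T}) (m : I -> T) :
    (forall i, injective (r i)) -> dominant r A ->
    (forall i, m i \in A) -> (forall i x, x \in A -> r i (m i) <= r i x) ->
  A \subset m @: setT.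
Proof.
move=> r_inj /dominantP domA mA mle; apply/subsetP => x xA.
have [i Hi] := domA x; apply/imsetP; exists i => //.
by apply: (r_inj i); apply/eqP; rewrite eqn_leq (Hi _ (mA i)) mle.
Qed.

(** The minima map the orders onto [D], which has one point fewer, so exactly one pair [i], [j]
    shares its minimum. An added point has to become least in one of these two orders while all
    other minima stay in place, and dominance forces it to be the highest candidate in that order.
    Each of the two orders yields one such point, and the two points differ. *)
Lemma card_extensions (r : I -> T -> nat) (D : {set T}) :
    (forall i, injective (r i)) ->
    #|D|.+1 = #|I| -> dominant r D -> D != set0 ->
    (forall i, exists y, forall l, l != i ->
       exists2 x, x \in D & r l x < r l y) ->
  #|[set x | (x \notin D) && dominant r (x |: D)]| = 2.
Proof.
move=> r_inj cardD domD /set0Pn[d0 d0D] Yne.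
pose m i := [arg min_(x < d0 in D) r i x].
have mD i : m i \in D by rewrite /m; case: arg_minnP.
have mle i x : x \in D -> r i (m i) <= r i x.
  by rewrite /m; case: arg_minnP => // y _ H /H.
have subDm := dominant_min r_inj domD mD mle.
have /injectivePn[i [j ij mij]] : ~~ injectiveb m.
  apply/negP => /injectiveP minj; have : #|m @: setT| <= #|D|.
    by apply/subset_leq_card/subsetP => _ /imsetP[k _ ->].
  by rewrite card_imset// cardsT -cardD ltnn.
have minj' (l : I) : {in [set~ l] &, injective m} -> (l == i) || (l == j).
  move=> H; apply/contraT => /norP[li lj]; have := H i j.
  by rewrite !inE eq_sym li eq_sym lj => /(_ isT isT mij)/eqP; rewrite (negbTE ij).
(* [m] hits [D] although one of [i], [j] is dropped, so each candidate that is
   above the minima in all the remaining orders is new and below [m] there. *)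
pose Y a := [set y | [forall l, (l != a) ==> (r l (m l) < r l y)]].
have inY a y : reflect (forall l, l != a -> r l (m l) < r l y) (y \in Y a).
  by rewrite inE; apply: (iffP forallP) => H l; have := H l; move/implyP.
have main a b : a != b -> m a = m b -> exists x, [/\ x \in Y a, x \notin D,
    r a x < r a (m a), dominant r (x |: D) &
    forall y, y \in Y a -> r a y <= r a x].
  move=> ab mab.
  have Yprop y : y \in Y a -> y \notin D /\ r a y < r a (m a).
    move=> /inY yY; split.
      apply/negP => /(subsetP subDm)/imsetP[l _ yl].
      have [la|/yY] := eqVneq l a; last by rewrite yl ltnn.
      by have := yY b; rewrite yl la -mab eq_sym ltnn ab => /(_ isT).
    have [l Hl] := dominantP _ _ domD y.
    have {Hl}yl := Hl _ (mD l).
    have la : l = a by apply/eqP/contraT => /yY; rewrite ltnNge yl.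
    rewrite la in yl; rewrite ltn_neqAle yl andbT; apply/eqP => /r_inj ya.
    by have := yY b; rewrite ya mab eq_sym ltnn ab => /(_ isT).
  have [y0 Hy0] := Yne a.
  have y0Y : y0 \in Y a by apply/inY => l /Hy0[x /(mle l)]; exact: leq_ltn_trans.
  exists [arg max_(x > y0 in Y a) r a x].
  case: arg_maxnP => // x xY xmax.
  have [xD xm] := Yprop _ xY; split => //.
  apply/dominantP => y; have [yY|] := boolP (y \in Y a).
    exists a => z; rewrite !inE => /predU1P[->|zD]; first exact: xmax.
    by rewrite (leq_trans (xmax _ yY))// (leq_trans (ltnW xm))// mle.
  rewrite inE negb_forall => /existsP[l]; rewrite negb_imply -leqNgt => /andP[la yl].
  exists l => z; rewrite !inE => /predU1P[->|zD].
    by rewrite (leq_trans yl)// ltnW//; move/inY: xY; exact.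
  by rewrite (leq_trans yl)// mle.
have [x1 [x1Y x1D x1m x1dom x1max]] := main i j ij mij.
have ji : j != i by rewrite eq_sym.
have [x2 [x2Y x2D x2m x2dom x2max]] := main j i ji (esym mij).
have x12 : x1 != x2.
  apply/eqP => E; move/inY: x2Y => /(_ i ij); rewrite -E.
  by rewrite ltnNge (ltnW x1m).
suff -> : [set x | (x \notin D) && dominant r (x |: D)] = [set x1; x2].
  by rewrite cards2 x12.
apply/setP => x; rewrite !inE; apply/andP/orP; last first.
  by move=> [/eqP->|/eqP->].
move=> [xD domx].
(* The minima of [x |: D] cover a set with as many points as there are orders, so they are pairwise
   distinct and [x] is least in a single order [l0]. *)
pose m' l := if r l x < r l (m l) then x else m l.
have m'D l : m' l \in x |: D.
  by rewrite /m' !inE; case: ifP; rewrite ?eqxx ?mD ?orbT.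
have m'le l z : z \in x |: D -> r l (m' l) <= r l z.
  rewrite /m' !inE => /predU1P[->|zD].
    by case: ltnP.
  by case: ltnP => [xl|_]; [rewrite (leq_trans (ltnW xl))// mle|exact: mle].
have sub' := dominant_min r_inj domx m'D m'le.
have m'inj : injective m'.
  have /eqP : #|m' @: setT| = #|[set: I]|.
    apply/eqP; rewrite eqn_leq leq_imset_card cardsT /=.
    by rewrite -cardD (leq_trans _ (subset_leq_card sub'))// cardsU1 xD.
  by move=> /imset_injP H u v; apply: H; rewrite inE.
have [l0 _ xl0] := imsetP (subsetP sub' _ (setU11 x D)).
have m'l l : l != l0 -> m' l = m l /\ r l (m l) < r l x.
  move=> ll0; rewrite {1}/m'; case: ltnP => [xl|].
    exfalso; suff /m'inj/eqP : m' l = m' l0 by rewrite (negbTE ll0).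
    by rewrite -xl0 /m' xl.
  move=> mx; split => //; rewrite ltn_neqAle mx andbT.
  by apply/eqP => /r_inj E; have := mD l; rewrite E (negbTE xD).
have xY : x \in Y l0 by apply/inY => l /m'l[].
have xmax y : y \in Y l0 -> r l0 y <= r l0 x.
  move=> /inY yY; have [l Hl] := dominantP _ _ domx y.
  have [<-|ll0] := eqVneq l l0; first by apply: Hl; rewrite setU11.
  by have := yY _ ll0; rewrite ltnNge Hl// inE mD orbT.
have : (l0 == i) || (l0 == j).
  apply: minj' => u v; rewrite !inE => /m'l[<- _] /m'l[<- _]; exact: m'inj.
case/orP => /eqP E; [left|right]; apply/eqP; rewrite E in xY xmax.
  by apply: (r_inj i); apply/eqP; rewrite eqn_leq x1max// xmax.
by apply: (r_inj j); apply/eqP; rewrite eqn_leq x2max// xmax.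
Qed.

(** If dropping [x0] leaves every colour but [i0], each once, then the colour of [x0] is not [i0],
    as [A] misses some colour. So exactly one other point [x1] shares it, and dropping [x1] is the
    only alternative. The count is 0 or 2. *)
Lemma card_facets (c : T -> I) (i0 : I) (A : {set T}) :
    #|A| = #|I| -> c @: A != setT ->
  ~~ odd #|[set x in A | c @: (A :\ x) == [set~ i0]]|.
Proof.
move=> cardA cA; have [->|/set0Pn[x0]] := 
  eqVneq [set x in A | c @: (A :\ x) == [set~ i0]] set0.
  by rewrite cards0.
rewrite inE => /andP[x0A /eqP cx0].
have cardC1 : #|[set~ i0]| = #|A|.-1 by rewrite cardsC1 cardA.
have : c x0 \in c @: (A :\ x0).
  rewrite cx0 !inE; apply: contra cA => /eqP cx0i.
  by rewrite -(setD1K x0A) imsetU1 cx0 cx0i setUCr.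
move=> /imsetP[x1]; rewrite !inE => /andP[x10 x1A] cx01.
suff -> : [set x in A | c @: (A :\ x) == [set~ i0]] = [set x0; x1].
  by rewrite cards2 eq_sym x10.
apply/setP => x; rewrite !inE; apply/andP/orP; last first.
  move=> [/eqP->|/eqP->]; split => //; rewrite ?cx0//.
  rewrite -cx0; apply/eqP/setP => z; apply/imsetP/imsetP => -[y].
    rewrite !inE => /andP[yx1 yA] ->; have [->|yx0] := eqVneq y x0.
      by exists x1; rewrite ?inE ?x10.
    by exists y; rewrite ?inE ?yx0.
  rewrite !inE => /andP[yx0 yA] ->; have [->|yx1] := eqVneq y x1.
    by exists x0; rewrite ?inE 1?eq_sym ?x10.
  by exists y; rewrite ?inE ?yx1.
move=> [xA /eqP cx].
have /imset_injP inj : #|c @: (A :\ x)| == #|A :\ x|.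
  by rewrite cx cardC1 (cardsD1 x A) xA.
have [->|xx0] := eqVneq x x0; [by left|right].
rewrite eq_sym; apply: contraT => x1x; have := inj x0 x1.
by rewrite !inE eq_sym xx0 x0A x1A x1x => /(_ isT isT cx01)/eqP; rewrite eq_sym (negbTE x10).
Qed.

Lemma sum_odd (J : finType) (P : pred J) (F : J -> nat) :
  (forall j, P j -> ~~ odd (F j)) -> ~~ odd (\sum_(j | P j) F j).
Proof.
move=> H; apply: (big_ind (fun n => ~~ odd n)) => // m n.
by rewrite oddD => /negbTE-> /negbTE->.
Qed.

(** Rooms are dominant sets of full size; doors are sets with one point fewer that bear exactly the
    colours other than [i0]. Pairs of a room and a door in it are counted in two ways. By rooms the
    total is even unless some room has all colours; by doors it is odd, since [D0] contributes an
    odd number and every other door 0 or 2. *)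
Lemma exists_colorful (r : I -> T -> nat) (c : T -> I) (i0 : I) (D0 : {set T}) :
    (forall i, injective (r i)) -> c @: D0 = [set~ i0] -> #|D0|.+1 = #|I| ->
    odd #|[set x | (x \notin D0) && dominant r (x |: D0)]| ->
    (forall D : {set T}, c @: D = [set~ i0] -> #|D|.+1 = #|I| -> D != D0 ->
       D != set0 /\ forall i, exists y, forall l, l != i ->
         exists2 x, x \in D & r l x < r l y) ->
  exists A : {set T}, [/\ #|A| = #|I|, dominant r A & c @: A = setT].
Proof.
move=> r_inj cD0 cardD0 oddD0 HD.
pose room (A : {set T}) := (#|A| == #|I|) && dominant r A.
pose door (D : {set T}) := (#|D|.+1 == #|I|) && (c @: D == [set~ i0]).
have [/existsP[A /andP[/andP[/eqP ? ?] /eqP ?]]|/existsPn noA] :=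
  boolP [exists A : {set T}, room A && (c @: A == setT)]; first by exists A.
exfalso.
have E : \sum_(A | room A) #|[set x in A | c @: (A :\ x) == [set~ i0]]| =
         \sum_(D | door D) #|[set x | (x \notin D) && dominant r (x |: D)]|.
  under eq_bigr do rewrite -sum1_card; rewrite (exchange_big_dep xpredT)//=.
  under [RHS]eq_bigr do rewrite -sum1_card; rewrite [RHS](exchange_big_dep xpredT)//=.
  apply: eq_bigr => x _.
  (* For fixed [x], removing it from a room and adding it to a door are inverse to each other. *)
  rewrite (reindex_onto (fun D : {set T} => x |: D) (fun A : {set T} => A :\ x)).
    apply: eq_bigl => D; rewrite !inE eqxx /= /room /door.
    have [xD|xD] := boolP (x \in D).
      rewrite !andbF; apply/negP => /andP[_ /eqP]; move/setP => /(_ x).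
      by rewrite !inE eqxx xD.
    have -> : (x |: D) :\ x = D by rewrite setU1K.
    by rewrite eqxx cardsU1 xD add1n !andbT /= andbAC.
  by move=> A /andP[_]; rewrite inE => /andP[xA _]; rewrite setD1K.
have evn : ~~ odd (\sum_(A | room A) #|[set x in A | c @: (A :\ x) == [set~ i0]]|).
  apply: sum_odd => A rA; apply: card_facets.
    by case/andP: rA => /eqP.
  by have := noA A; rewrite rA.
move: evn; rewrite E (bigD1 D0) /=; last by rewrite /door cardD0 cD0 !eqxx.
rewrite oddD oddD0 addTb negbK; apply/negP; apply: sum_odd => D.
move=> /andP[/andP[/eqP cardD /eqP cD] DD0].
have [domD|ndomD] := boolP (dominant r D); last first.
  suff -> : [set x | (x \notin D) && dominant r (x |: D)] = set0 by rewrite cards0.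
  apply/setP => x; rewrite !inE.
  apply/negP => /andP[_]; apply/negP; apply: contra ndomD.
  by apply: dominant_sub; exact: subsetUr.
by have [Dn0 HY] := HD D cD cardD DD0; rewrite card_extensions.
Qed.

End dominance.

(** One slack point per order supplies the starting door: all slack points except that of the colour
    of [t0]. Afterwards the slack points can be discarded: the one coloured [i] is least in the
    order [i], so an order that dominates a point of [T] takes its colour from a point of [T]. *)
Lemma scarf (T I : finType) (t0 : T) (r : I -> T -> nat) (c : T -> I) :
    (forall i, injective (r i)) ->
  exists A : {set T}, forall y, exists2 i, i \in c @: A &
    forall x, x \in A -> r i y <= r i x.
Proof.
move=> r_inj.
pose M := \max_i \max_t r i t.
have rM i t : r i t <= M.
  by rewrite (leq_trans (leq_bigmax t))//; exact: (@leq_bigmax _ (fun i => \max_t r i t)).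
(* The slack point [inr j] is least in the order [j], above [T] in the others. *)
pose R i (x : T + I) := match x with
  | inl t => (r i t).+1
  | inr j => if j == i then 0 else M.+2 + enum_rank j end.
pose C (x : T + I) := match x with inl t => c t | inr j => j end.
have R_inj i : injective (R i).
  move=> [x|x] [y|y] /=.
  - by move=> [/r_inj->].
  - by case: eqP => // _; have := rM i x; lia.
  - by case: eqP => // _; have := rM i y; lia.
  - case: eqP => [->|_]; case: eqP => [->|_] //.
    by move=> /addnI/val_inj/enum_rank_inj->.
pose i0 := c t0; pose D0 : {set T + I} := inr @: [set~ i0].
have inrI : injective (@inr T I) by move=> x y [].
have CD0 : C @: D0 = [set~ i0].
  by rewrite /D0 -imset_comp (eq_imset _ (_ : _ =1 id)) ?imset_id.
have D0l t : inl t \in D0 = false by apply/negP => /imsetP[].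
have D0r j : inr j \in D0 = (j != i0) by rewrite /D0 mem_imset// !inE.
have cardD0 : #|D0|.+1 = #|I|.
  by rewrite /D0 card_imset// cardsC1 prednK//; apply/card_gt0P; exists i0.
have [A [cardA domA CA]] : exists A : {set T + I},
    [/\ #|A| = #|I|, dominant R A & C @: A = setT].
  apply: (exists_colorful R_inj CD0 cardD0).
    (* In an order other than [i0] some slack point of [D0] is least, so [x0] can be dominated only
       in the order [i0]. This leaves no extension of [D0] but [x0]. *)
    pose x0 := [arg max_(t > t0) r i0 t].
    suff -> : [set x | (x \notin D0) && dominant R (x |: D0)] = [set inl x0].
      by rewrite cards1.
    apply/setP => x; rewrite !inE; apply/andP/eqP.
      move=> [xD0 /dominantP dx].
      have : r i0 x0 < R i0 x.
        have [i Hi] := dx (inl x0).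
        have ii0 : i = i0.
          apply/eqP/contraT => ii0; have := Hi (inr i).
          by rewrite !inE D0r ii0 orbT /= eqxx => /(_ isT).
        by rewrite -ii0; apply: Hi; rewrite setU11.
      case: x xD0 dx => [t|j]; last first.
        by rewrite D0r negbK /= => /eqP->; rewrite eqxx.
      move=> _ _ /=; rewrite ltnS /x0; case: arg_maxnP => // x _ xmax xt; congr inl.
      by apply: (r_inj i0); apply/eqP; rewrite eqn_leq xt andbT; exact: xmax.
    move=> ->; rewrite D0l; split => //; apply/dominantP => -[t|j].
      exists i0 => -[t'|j']; rewrite !inE ?D0l ?D0r /=.
        rewrite orbF => /eqP[->]; rewrite ltnS /x0.
        by case: arg_maxnP => // z _; exact.
      by case: eqP => //= _ _; have := rM i0 t; lia.
    by exists j => z _ /=; rewrite eqxx.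
  move=> D CD cardD DD0.
  have [t tD] : exists t, inl t \in D.
    have [/existsP[t tD]|/existsPn noD] := boolP [exists t, inl t \in D].
      by exists t.
    case/negP: DD0.
    have inD0 x : x \in D -> x \in D0.
      case: x => [t tD|j jD]; first by have := noD t; rewrite tD.
      rewrite D0r; have : C (inr j) \in C @: D by apply: imset_f.
      by rewrite CD !inE.
    by rewrite eqEcard -ltnS cardD0 -cardD leqnn andbT; apply/subsetP.
  split; first by apply/set0Pn; exists (inl t).
  (* In every order but its own a slack point is above all of [T], hence above the point [t] of
     [D]. *)
  move=> i; exists (inr i) => l li; exists (inl t) => //=.
  by rewrite eq_sym (negbTE li); have := rM l t; lia.
have Cinj : {in A &, injective C} by apply/imset_injP; rewrite CA cardsT cardA.
exists [set t | inl t \in A] => y.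
have [i Hi] := dominantP _ _ domA (inl y).
have : i \in C @: A by rewrite CA inE.
case/imsetP => -[t|j] xA /= ij; last first.
  by have := Hi _ xA; rewrite /= ij eqxx.
exists i; first by rewrite ij; apply: imset_f; rewrite inE.
by move=> x; rewrite inE => /Hi /=; rewrite ltnS.
Qed.

From mathcomp Require Import all_order all_algebra.
From mathcomp Require Import all_classical all_reals all_analysis.
From mathcomp Require Import finmap measurable_realfun ring lra.
Import Order.TTheory GRing.Theory Num.Theory.
Import numFieldNormedType.Exports.
Local Open Scope classical_set_scope.
Local Open Scope ring_scope.

(** * Brouwer's theorem on a simplex *)

Section brouwer.
Context {R : realType} {n : nat}.

Definition simplex : set 'rV[R]_n.+1 :=
  [set a | (forall i, 0 <= a ord0 i) /\ \sum_i a ord0 i = 1].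

Lemma simplex_le1 a i : simplex a -> a ord0 i <= 1.
Proof.
move=> [a0 <-]; rewrite (bigD1 i)//= lerDl; exact: sumr_ge0.
Qed.

Lemma closed_simplex : closed simplex.
Proof.
have -> : simplex = (\bigcap_(i in [set: 'I_n.+1])
    ((fun a : 'rV[R]_n.+1 => a ord0 i) @^-1` [set x | 0 <= x])) `&`
    ((fun a : 'rV[R]_n.+1 => \sum_i a ord0 i) @^-1` [set 1]).
  apply/seteqP; split=> a [a0 a1]; split => //; first by move=> i _; exact: a0.
  by move=> i; exact: (a0 i).
apply: closedI.
  apply: closed_bigI => i _; apply: preimage_closed; last exact: closed_ge.
  by move=> x _; exact: coord_continuous.
apply: preimage_closed; last exact: closed_eq.
move=> x _; apply: (@cvg_big R _ +%R 0 xpredT _ _ (nbhs x)) => [|i _]; first exact: add_continuous.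
exact: coord_continuous.
Qed.

Lemma compact_simplex : compact simplex.
Proof.
apply: bounded_closed_compact; last exact: closed_simplex.
exists 1; split => // M M1 a /= sa.
rewrite [leLHS]/Num.norm/= mx_normrE; apply/bigmax_leP => /=; split.
  by rewrite (le_trans _ (ltW M1)).
move=> [i j] _ /=; rewrite (ord1 i) ger0_norm; last by case: sa.
by rewrite (le_trans (simplex_le1 j sa))// ltW.
Qed.

Lemma sum_le_eq (I : finType) (x y : I -> R) :
  (forall i, x i <= y i) -> \sum_i x i = \sum_i y i -> forall i, x i = y i.
Proof.
move=> xy /eqP; rewrite eq_sym -subr_eq0 -sumrB psumr_eq0; last first.
  by move=> i _; rewrite subr_ge0.
by move=> /allP E i; apply/esym/eqP; rewrite -subr_eq0; apply: E; rewrite mem_index_enum.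
Qed.

Definition grid (M : nat) : finType :=
  {t : {ffun 'I_n.+1 -> 'I_M.+1} | (\sum_i (t i : nat))%N == M}.

Definition gridpt (M : nat) (t : grid M) : 'rV[R]_n.+1 :=
  \row_i ((val t i : nat)%:R / M%:R).

Lemma simplex_gridpt M (t : grid M.+1) : simplex (gridpt t).
Proof.
split=> [i|]; first by rewrite mxE divr_ge0.
under eq_bigr do rewrite mxE.
by rewrite -mulr_suml -natr_sum (eqP (valP t)) divff// pnatr_eq0.
Qed.

Lemma exists_grid M (c : 'I_n.+1 -> nat) : (\sum_i c i <= M)%N ->
  exists t : grid M, forall i, (c i <= val t i)%N.
Proof.
move=> cM; pose d i := (if i == ord0 then c i + (M - \sum_i c i) else c i)%N.
have dM : (\sum_i d i = M)%N.
  rewrite /d (bigD1 ord0)//=.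
  rewrite [X in (_ + X)%N = _](eq_bigr c); last by move=> i /negbTE->.
  by move: cM; rewrite [X in (X <= _)%N -> _](bigD1 ord0)//= [X in (M - X)%N](bigD1 ord0)//=; lia.
have dlt i : (d i < M.+1)%N by rewrite ltnS -dM (bigD1 i)//= leq_addr.
pose t : {ffun 'I_n.+1 -> 'I_M.+1} := [ffun i => Ordinal (dlt i)].
have tM : (\sum_i (t i : nat))%N == M.
  by rewrite -[X in _ == X]dM; apply/eqP/eq_bigr => i _; rewrite ffunE.
exists (exist (fun t : {ffun 'I_n.+1 -> 'I_M.+1} => (\sum_i (t i : nat))%N == M) t tM) => i /=; rewrite ffunE /= /d.
by case: ifP => // _; rewrite leq_addr.
Qed.

(** The total excess of [x] over [mu] on [C], together with the sum of [x] outside [C], is less than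
    the size of [C]. All terms are nonnegative, so each of them is too. *)
Lemma cell_bound (I : finType) (C : {set I}) (mu x : I -> nat) M :
    (forall i, i \in C -> mu i <= x i)%N -> (\sum_i x i = M)%N ->
    (M < \sum_(i in C) (mu i).+1)%N ->
  forall j, (x j <= (if j \in C then mu j else 0) + #|I|)%N.
Proof.
move=> mux <- lt j.
have {lt} : (\sum_i x i < \sum_(i in C) mu i + #|I|)%N.
  rewrite (leq_trans lt)//; under eq_bigr do rewrite -addn1.
  by rewrite big_split/= leq_add2l sum1_card max_card.
rewrite (bigID (mem C))/=; have [jC|jC] := boolP (j \in C).
  have : (\sum_(i in C | i != j) mu i <= \sum_(i in C | i != j) x i)%N.
    by apply: leq_sum => i /andP[iC _]; exact: mux.
  rewrite [X in (X + _ < _)%N](bigD1 j)//= [X in (_ < X + _)%N](bigD1 j)//=; lia.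
have : (\sum_(i in C) mu i <= \sum_(i in C) x i)%N by apply: leq_sum.
by rewrite [X in (_ + X < _)%N](bigD1 j)//=; lia.
Qed.

(* A dominant set of grid points lies in a cell of side [n.+1 / M], by comparing
   coordinate sums. *)
Lemma approx_fixpoint M (f : 'I_n.+1 -> 'rV[R]_n.+1 -> R) :
    (forall a, simplex a -> \sum_i f i a = 1) ->
    (forall i a, simplex a -> 0 <= f i a) ->
  exists2 a, simplex a & forall i, exists b, [/\ simplex b,
    forall j, `|a ord0 j - b ord0 j| <= n.+1%:R / M.+1%:R &
    b ord0 i <= f i b + n.+1%:R / M.+1%:R].
Proof.
move=> f1 f0; pose T := grid M.+1.
have [t0 _] : exists t : T, forall i, (0 <= val t i)%N.
  by apply: (@exists_grid _ (fun=> 0%N)); rewrite big1.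
(* The coordinates of a point and those of its image both sum to 1, so the former cannot all exceed
   the latter. The colour is a coordinate that does not. *)
have colour (t : T) : {i | gridpt t ord0 i <= f i (gridpt t)}.
  have [i Hi|noi] := pickP (fun i => gridpt t ord0 i <= f i (gridpt t)).
    by exists i.
  exfalso; have : \sum_i f i (gridpt t) < \sum_i gridpt t ord0 i.
    apply: ltr_sum => [|i _]; last by rewrite ltNge noi.
    by apply/hasP; exists ord0; rewrite ?mem_index_enum.
  by rewrite f1 ?(simplex_gridpt t).2 ?ltxx//; exact: simplex_gridpt.
pose c t := sval (colour t).
(* The rank breaks ties, which makes each coordinate order injective. *)
pose r (i : 'I_n.+1) (t : T) := (val t i * #|T| + enum_rank t)%N.
have r_inj i : injective (r i).
  move=> s t E; apply: enum_rank_inj; apply: ord_inj.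
  by rewrite -(modn_small (ltn_ord (enum_rank s))) -(modnMDl (val s i))
    [(_ + _)%N]E modnMDl modn_small.
have r_le i (s t : T) : (r i s <= r i t -> val s i <= val t i)%N.
  rewrite [leqLHS]/r [leqRHS]/r => E; rewrite leqNgt; apply/negP => lt.
  have : (val t i * #|T| + #|T| <= val s i * #|T|)%N.
    by rewrite addnC -mulSn leq_mul2r lt orbT.
  move=> /leq_trans/(_ (leq_addr (enum_rank s) _))/leq_trans/(_ E).
  by rewrite leq_add2l leqNgt ltn_ord.
have [A domA] := scarf t0 c r_inj.
pose C := finset.imset c (mem A).
have [x0 x0A] : exists x, x \in A.
  by have [_ /imsetP[x xA _] _] := domA t0; exists x.
pose mu i := val [arg min_(x < x0 in A) val x i]%N i : nat.
have muA i : exists2 x : T, x \in A & mu i = val x i.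
  by rewrite /mu; case: arg_minnP => // x xA _; exists x.
have mule i x : x \in A -> (mu i <= val x i)%N.
  by rewrite /mu; case: arg_minnP => // y _ H /H.
(* Otherwise some grid point would exceed, for every colour [i] of [A], the least [i]-th coordinate
   in [A], against dominance. *)
have sumC : (M.+1 < \sum_(i in C) (mu i).+1)%N.
  rewrite ltnNge; apply/negP => le.
  have [|y Hy] := @exists_grid M.+1 (fun i => if i \in C then (mu i).+1 else 0%N).
    by rewrite -big_mkcond.
  have [i iC Hi] := domA y.
  have [x xA mux] := muA i.
  have := Hy i; rewrite iC => /leq_trans/(_ (r_le _ _ _ (Hi x xA))).
  by rewrite mux ltnn.
have cell x y j : x \in A -> y \in A -> (val x j <= val y j + n.+1)%N.
  move=> xA yA.
  rewrite (leq_trans (cell_bound (fun i _ => mule i x xA) (eqP (valP x)) sumC j))//.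
  by rewrite card_ord leq_add2r; case: ifP => // _; exact: mule.
have dist x y j : x \in A -> y \in A ->
    `|gridpt x ord0 j - gridpt y ord0 j| <= n.+1%:R / M.+1%:R.
  move=> xA yA; rewrite !mxE -mulrBl normrM normfV normr_nat.
  rewrite ler_pM2r ?invr_gt0 ?ltr0n//.
  have := cell x y j xA yA; have := cell y x j yA xA.
  rewrite -!(ler_nat R) !natrD => yx xy; rewrite ler_norml; lra.
exists (gridpt x0); first exact: simplex_gridpt.
(* For a colour [i] of [A], a point that bears it serves as [b]. For any other [i] the [i]-th
   coordinate of [x0] is itself below the tolerance. *)
move=> i; have [/imsetP[y yA iy]|iC] := boolP (i \in C).
  exists (gridpt y); split; [exact: simplex_gridpt|by move=> j; exact: dist|].
  rewrite iy (le_trans (svalP (colour y)))// lerDl divr_ge0//.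
exists (gridpt x0); split; [exact: simplex_gridpt|by move=> j; exact: dist|].
rewrite ler_wpDl//; first exact/f0/simplex_gridpt.
rewrite mxE ler_pM2r ?invr_gt0 ?ltr0n// ler_nat.
have := cell_bound (fun i _ => mule i x0 x0A) (eqP (valP x0)) sumC i.
by rewrite (negbTE iC) card_ord.
Qed.

(** At a cluster point of the approximate fixed points no coordinate exceeds that of the image. Both
    families sum to 1, so they agree. *)
Lemma brouwer_simplex (f : 'I_n.+1 -> 'rV[R]_n.+1 -> R) :
    (forall a, simplex a -> \sum_i f i a = 1) ->
    (forall i a, simplex a -> 0 <= f i a) ->
    (forall i, {within simplex, continuous (f i)}) ->
  exists2 a, simplex a & forall i, f i a = a ord0 i.
Proof.
move=> f1 f0 fc.
have H M := approx_fixpoint M f1 f0.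
pose a M := sval (cid2 (H M)).
have sa M : simplex (a M) by rewrite /a; case: cid2.
have Ha M i : exists b, [/\ simplex b,
    forall j, `|a M ord0 j - b ord0 j| <= n.+1%:R / M.+1%:R &
    b ord0 i <= f i b + n.+1%:R / M.+1%:R].
  by rewrite /a; case: cid2 => /= x _; exact.
have [|p [sp cp]] := @compact_simplex (a @ \oo) _.
  by exists 0%N => // M _; exact: sa.
exists p => // i; apply/esym; move: i; apply: sum_le_eq; last first.
  by rewrite f1//; case: sp.
move=> i; apply/ler_addgt0Pr => e e0.
have e4 : 0 < e / 4 by rewrite divr_gt0.
have /subspace_continuousP/(_ p sp)/cvgrPdist_lt/(_ _ e4) := fc i.
move=> /nbhs_ballP[d /= d0 Hd].
(* [b] is within [2 e'] of [p], the inequality at [b] loses another [e'], and continuity loses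
   [e / 4]: at most [e] in all. The bound [d / 2] keeps [b] in the ball where continuity applies. *)
pose e' := Num.min (d / 2) (e / 4).
have e'0 : 0 < e' by rewrite lt_min e4 divr_gt0.
have small : \forall M \near \oo, n.+1%:R / M.+1%:R < e'.
  near=> M; rewrite ltr_pdivrMr ?ltr0n// mulrC -ltr_pdivrMr//.
  rewrite (@lt_trans _ _ M%:R) ?ltr_nat//.
  by near: M; exact: nbhs_infty_gtr.
have [|q []] := cp [set a M | M in [set M | n.+1%:R / M.+1%:R < e']]
    (ball p e') _ (nbhsx_ballx p e' e'0).
  by apply: filterS small => M HM; exists M.
move=> [M /= HM <-] [_ pa].
have [b [sb ab bf]] := Ha M i.
have pb j : `|p ord0 j - b ord0 j| < e' + e'.
  rewrite -(subrKA (a M ord0 j)) (le_lt_trans (ler_normD _ _))// ltrD//.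
    exact: pa.
  by rewrite (le_lt_trans (ab j)).
have e'd : e' + e' <= d.
  by have : e' <= d / 2 by [rewrite ge_min lexx]; lra.
have /Hd /(_ sb) : ball p d b.
  split => // i' j; rewrite (ord1 i') /ball/=.
  by rewrite (lt_le_trans (pb j)).
have : e' <= e / 4 by rewrite ge_min lexx orbT.
rewrite /from_subspace /= => ee' fpb; have := pb i; move: fpb.
move: bf HM e0; rewrite !ltr_norml; move: (_ / M.+1%:R) (f i p) (f i b) => x y z.
by clear -ee' => ? ? ? /andP[? ?] /andP[? ?]; clearbody e'; lra.
Unshelve. all: by end_near. Qed.

End brouwer.

(** * Schauder's theorem *)

Section schauder.
Context {R : realType} {V : normedModType R}.

Definition convex_in (D : set V) := forall x y t,
  D x -> D y -> 0 <= t -> t <= 1 -> D (t *: x + (1 - t) *: y).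

(** Convexity concerns two points, so the induction runs over partial sums rescaled to total weight
    1. A tail of weight zero cannot be rescaled and is dropped separately. *)
Lemma convex_in_sum (D : set V) n (y : 'I_n.+1 -> V) (a : 'rV[R]_n.+1) :
  convex_in D -> (forall i, D (y i)) -> simplex a ->
  D (\sum_i a ord0 i *: y i).
Proof.
move=> cD Dy [a0 a1].
suff H (s : seq 'I_n.+1) : 0 < \sum_(i <- s) a ord0 i ->
    D ((\sum_(i <- s) a ord0 i)^-1 *: \sum_(i <- s) a ord0 i *: y i).
  by have := H (index_enum _); rewrite a1 ltr01 invr1 scale1r; exact.
elim: s => [|j s IH]; first by rewrite big_nil ltxx.
rewrite !big_cons => S0; set S := \sum_(i <- s) _ in S0 IH *.
have Sge0 : 0 <= S by exact: sumr_ge0.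
have [S_eq0|S_neq0] := eqVneq S 0.
  have -> : \sum_(i <- s) a ord0 i *: y i = 0.
    apply: big1_seq => i /andP[_ is_]; suff -> : a ord0 i = 0 by rewrite scale0r.
    apply/eqP; move/eqP: S_eq0; rewrite /S psumr_eq0 => [/allP/(_ i is_)//|k _].
    exact: a0.
  rewrite S_eq0 !addr0 scalerA mulVf ?scale1r// gt_eqF//.
  by move: S0; rewrite S_eq0 addr0.
have {}IH := IH (ltac:(by rewrite lt_neqAle eq_sym S_neq0)).
have -> : (a ord0 j + S)^-1 *: (a ord0 j *: y j + \sum_(i <- s) a ord0 i *: y i) =
    (a ord0 j / (a ord0 j + S)) *: y j + (1 - a ord0 j / (a ord0 j + S)) *:
       (S^-1 *: \sum_(i <- s) a ord0 i *: y i).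
  rewrite scalerDr !scalerA mulrC; congr (_ + _ *: _).
  by field; rewrite S_neq0 gt_eqF.
apply: cD => //; first by rewrite divr_ge0// ltW.
by rewrite ler_pdivrMr// mul1r lerDl.
Qed.

Variables (D Q : set V) (f : V -> V).
Hypotheses (D0 : D !=set0) (convD : convex_in D) (closedD : closed D).
Hypotheses (cptQ : compact Q) (fD : forall v, D v -> D (f v) /\ Q (f v)).
Hypothesis fcont : {within D, continuous f}.

(** A finite [e]-net [y] of the image gives a map [g] from a simplex to [D]. The weights [h],
    supported on the [y i] closer than [e] to [f (g a)], lead back to the simplex. At a fixed point
    [a] of [h], [g a] is an average of such [y i] only. *)
Lemma schauder_approx e : 0 < e -> exists2 v, D v & `|v - f v| <= e.
Proof.
move=> e0.
have cptI : compact (closure (f @` D)).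
  apply: subclosed_compact cptQ _; first exact: closed_closure.
  have clQ : closed Q by apply: compact_closed => //; exact: norm_hausdorff.
  by move/closure_id: clQ => ->; apply: closureS => _ [v Dv <-]; case: (fD Dv).
move: cptI; rewrite compact_cover => /(_ V (f @` D) (fun y => ball y e)) [].
- by move=> y _; exact: ball_open.
- move=> x /(_ (ball x e) (nbhsx_ballx x e e0)) [y [fy xy]].
  by exists y => //; exact: ball_sym.
move=> s sD cov.
have covs x : (f @` D) x -> exists2 y, y \in s & `|x - y| < e.
  move=> /subset_closure/cov[y /= ys yx]; exists y => //.
  by rewrite distrC; move: yx; rewrite -ball_normE.
have [v0 Dv0] := D0.
have [y0 y0s _] := covs (f v0) (ex_intro2 _ _ v0 Dv0 erefl).
pose l : seq V := s.
have [n sz] : exists n, size l = n.+1.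
  have : (0 < size l)%N by case: l (y0s : y0 \in l).
  by case: (size l) => // n _; exists n.
pose y (i : 'I_n.+1) : V := nth 0 l i.
have Dy i : D (y i).
  have /sD : y i \in s by apply: mem_nth; rewrite sz.
  by move=> /set_mem[v Dv <-]; case: (fD Dv).
pose g (a : 'rV[R]_n.+1) := \sum_i a ord0 i *: y i.
have Dg a : simplex a -> D (g a) by exact: convex_in_sum.
pose phi i x := Num.max 0 (e - `|x - y i|).
have phi0 i x : 0 <= phi i x by rewrite le_max lexx.
have S0 a : simplex a -> 0 < \sum_i phi i (f (g a)).
  move=> sa; have [z zs xz] := covs (f (g a)) (ex_intro2 _ _ (g a) (Dg a sa) erefl).
  have zi : (index z l < n.+1)%N by rewrite -sz index_mem.
  rewrite (bigD1 (Ordinal zi))//= ltr_pwDl//; last by apply: sumr_ge0.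
  by rewrite lt_max /y /= nth_index// subr_gt0 xz orbT.
pose h i a := phi i (f (g a)) / \sum_j phi j (f (g a)).
have gcont : continuous g.
  move=> a; apply: (@cvg_big V _ +%R 0 xpredT _ _ (nbhs a)) => [|i _].
    exact: add_continuous.
  by apply: cvgZr_tmp; exact: coord_continuous.
have phicont i : continuous (phi i).
  move=> x; apply: (@continuous_max R V (fun=> 0) (fun x => e - `|x - y i|)).
    exact: cvg_cst.
  apply: cvgB; first exact: cvg_cst.
  by apply: cvg_norm; apply: cvgB; [exact: cvg_id|exact: cvg_cst].
have fgcont i : {within @simplex R n, continuous (fun a => phi i (f (g a)))}.
  apply/subspace_continuousP => a sa.
  apply: (@cvg_comp _ _ _ (f \o g) (phi i)); last exact: phicont.
  have /subspace_continuousP/(_ _ (Dg a sa)) fa := fcont.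
  apply: cvg_comp fa => P /= HP.
  have {}HP : nbhs a (fun b => D (g b) -> P (g b)) := gcont a _ HP.
  suff : nbhs a (fun b => simplex b -> P (g b)) by [].
  by apply: filterS HP => b Hb sb; apply: Hb; exact: Dg.
have [||j|a sa ha] := brouwer_simplex (f := h).
- move=> a sa; rewrite -mulr_suml divff// gt_eqF//; exact: S0.
- by move=> i a sa; rewrite divr_ge0// ltW// S0.
- apply/subspace_continuousP => a sa.
  have /subspace_continuousP ca := fgcont j; apply: cvgM; first exact: ca.
  apply: cvgV; first by rewrite gt_eqF// S0.
  apply: (@cvg_big R _ +%R 0 xpredT _ _ (within _ (nbhs a))) => [|i _].
    exact: add_continuous.
  by have /subspace_continuousP := fgcont i; exact.
exists (g a); first exact: Dg.
have [a0 a1] := sa.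
have -> : g a - f (g a) = \sum_i a ord0 i *: (y i - f (g a)).
  by under [RHS]eq_bigr do rewrite scalerBr; rewrite sumrB -scaler_suml a1 scale1r.
rewrite (le_trans (ler_norm_sum _ _ _))// -[leRHS]mul1r -a1 mulr_suml.
apply: ler_sum => i _; rewrite normrZ ger0_norm//.
have [->|ai] := eqVneq (a ord0 i) 0; first by rewrite !mul0r.
rewrite ler_wpM2l// distrC leNgt; apply/negP => lt.
move/eqP: ai; apply; rewrite -ha /h /phi; apply/eqP.
rewrite mulf_eq0 -/(phi _ _); apply/orP; left; apply/eqP.
by apply/max_idPl; rewrite subr_le0 ltW.
Qed.

(** A cluster point of the images of ever better approximate fixed points is also a cluster point of
    these points themselves. So it lies in the closed set [D], where continuity makes it fixed. *)
Lemma schauder : exists2 v, D v & f v = v.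
Proof.
have H M : exists2 v, D v & `|v - f v| <= M.+1%:R^-1.
  by apply: schauder_approx; rewrite invr_gt0.
pose v M := sval (cid2 (H M)).
have Dv M : D (v M) by rewrite /v; case: cid2.
have vM M : `|v M - f (v M)| <= M.+1%:R^-1 by rewrite /v; case: cid2.
have [|p [Qp cp]] := cptQ (F := (f \o v) @ \oo) _.
  by exists 0%N => // M _; case: (fD (Dv M)).
have near_p e : 0 < e -> exists M, `|p - f (v M)| < e /\ `|p - v M| < e.
  move=> e0; have e2 : 0 < e / 2 by rewrite divr_gt0.
  have small : \forall M \near \oo, M.+1%:R^-1 < e / 2.
    near=> M; rewrite -[ltRHS]invrK ltf_pV2 ?posrE ?invr_gt0//.
    rewrite (@lt_trans _ _ M%:R) ?ltr_nat//.
    by near: M; exact: nbhs_infty_gtr.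
  have [|q []] := cp [set f (v M) | M in [set M | M.+1%:R^-1 < e / 2]]
      (ball p (e / 2)) _ (nbhsx_ballx p _ e2).
    by apply: filterS small => M HM; exists M.
  move=> [M /= HM <-]; rewrite -ball_normE /= => pf.
  exists M; split; first by rewrite (lt_trans pf)// ltr_pdivrMr// ltr_pMr// ltr1n.
  rewrite -(subrKA (f (v M))) (le_lt_trans (ler_normD _ _))//.
  rewrite [ltRHS](splitr e) ltrD// distrC.
  by rewrite (le_lt_trans (vM M)).
have Dp : D p.
  apply: closedD => B /nbhs_ballP[e /= e0 eB].
  have [M [_ Hv]] := near_p e e0; exists (v M); split => //; apply: eB.
  by rewrite -ball_normE.
exists p => //; apply/esym/eqP; rewrite -subr_eq0 -normr_le0.
apply/ler_addgt0Pl => e e0; rewrite addr0.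
have e2 : 0 < e / 2 by rewrite divr_gt0.
have /subspace_continuousP/(_ p Dp)/cvgrPdist_lt/(_ _ e2) := fcont.
move=> /nbhs_ballP[d /= d0 Hd].
have [|M [Hf Hv]] := near_p (Num.min d (e / 2)).
  by rewrite lt_min d0.
have /Hd/(_ (Dv M)) : ball p d (v M).
  by rewrite -ball_normE /=; move: Hv; rewrite lt_min => /andP[].
rewrite /from_subspace => ff; rewrite ltW// -(subrKA (f (v M))).
rewrite (le_lt_trans (ler_normD _ _))// [ltRHS](splitr e) ltrD//.
  by move: Hf; rewrite lt_min => /andP[].
by rewrite distrC.
Unshelve. all: by end_near. Qed.

End schauder.

(** * Birkhoff-Kellogg theorem in a cone *)

Section birkhoff_kellogg.
Context {R : realType} {V : normedModType R}.
Variables (P Q : set V) (ell : V -> R) (N : V -> V) (e : V) (rho c : R).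
Let S := [set v | P v /\ `|v| = rho].
Hypotheses (closedP : closed P) (PD : forall x y, P x -> P y -> P (x + y))
  (PZ : forall t x, 0 <= t -> P x -> P (t *: x)).
Hypotheses (rho0 : 0 < rho) (c0 : 0 < c) (cptQ : compact Q).
Hypotheses (ellD : forall x y, ell (x + y) = ell x + ell y)
  (ellZ : forall t x, ell (t *: x) = t * ell x)
  (ell_le : forall x, ell x <= `|x|).
Hypotheses (Pe : P e) (elle : 0 < ell e).
Hypotheses (NP : forall v, S v -> [/\ P (N v), Q (N v) & c <= ell (N v)])
  (Ncont : {within S, continuous N}).

Let D := [set v | P v /\ `|v| <= rho].
(** Radial projection to the sphere. Its value at 0 is 0, off the sphere, but [W] gives it weight 0
    there. *)
Let nrm (v : V) := (rho / `|v|) *: v.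
(* The second term keeps [W] away from 0 inside the ball, where nothing is
   known about [N]. *)
Let W v := (`|v| / rho) *: N (nrm v) + (rho - `|v|) *: e.
Let f v := (rho / `|W v|) *: W v.
Let c' := Num.min c (rho * ell e).

Let c'0 : 0 < c'. Proof. by rewrite lt_min c0 mulr_gt0. Qed.

Let S_nrm v : P v -> v != 0 -> S (nrm v).
Proof.
move=> Pv v0; split; first by apply: PZ => //; rewrite divr_ge0// ltW.
rewrite normrZ ger0_norm; last by rewrite divr_ge0// ltW.
by rewrite divfK// normr_eq0.
Qed.

Let PW v : D v -> P (W v).
Proof.
move=> [Pv vr]; apply: PD; last by apply: PZ; rewrite ?subr_ge0.
have [->|v0] := eqVneq v 0.
  by rewrite normr0 mul0r scale0r -[0](scale0r e); exact: PZ.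
apply: PZ; first by rewrite divr_ge0// ltW.
by have [] := NP (S_nrm Pv v0).
Qed.

(** With [t = |v| / rho], [W v] is [t] times [N (nrm v)] plus [1 - t] times [rho *: e]. So
    [ell (W v)] is a convex combination of a number at least [c] and of [rho * ell e]. *)
Let ellW v : D v -> c' <= `|W v|.
Proof.
move=> [Pv vr]; apply: le_trans (ell_le _); rewrite ellD !ellZ.
have [->|v0] := eqVneq v 0.
  by rewrite normr0 mul0r mul0r add0r subr0 ge_min lexx orbT.
have [_ _ cN] := NP (S_nrm Pv v0).
have t0 : 0 <= `|v| / rho by rewrite divr_ge0// ltW.
have E : rho - `|v| = (1 - `|v| / rho) * rho by rewrite mulrBl divfK ?mul1r// gt_eqF.
have t1 : 0 <= 1 - `|v| / rho by rewrite subr_ge0 ler_pdivrMr// mul1r.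
rewrite E -[(1 - _) * rho * _]mulrA (@le_trans _ _ (`|v| / rho * c' + (1 - `|v| / rho) * c'))//.
  by rewrite -mulrDl addrC subrK mul1r.
by rewrite lerD// ler_wpM2l// ?ge_min ?lexx ?orbT// (le_trans _ cN)// ge_min lexx.
Qed.

Let W_gt0 v : D v -> 0 < `|W v|.
Proof. by move=> /ellW; exact: lt_le_trans. Qed.

Let norm_f v : D v -> `|f v| = rho.
Proof.
move=> Dv; rewrite /f normrZ ger0_norm; last by rewrite divr_ge0// ltW.
by rewrite divfK// gt_eqF// W_gt0.
Qed.

(** Only 0 is delicate. The projection has no limit there in general, but the values of [N] stay in
    the bounded set [Q] and carry the factor [|x| / rho], which tends to 0. *)
Let Wcont : {within D, continuous W}.
Proof.
apply/subspace_continuousP => v [Pv vr].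
have cnorm : `|x| @[x --> within D (nbhs v)] --> `|v|.
  by apply: cvg_norm; apply: cvg_within_filter; exact: cvg_id.
apply: cvgD; last first.
  by apply: cvgZr_tmp; apply: cvgB; [exact: cvg_cst|exact: cnorm].
have [v0|v0] := eqVneq v 0.
  have [M [Mreal HM]] := compact_bounded cptQ.
  have MQ x : Q x -> `|x| <= `|M| + 1.
    by move=> Qx; apply: (HM (`|M| + 1)) => //; rewrite ltr_pwDr// ler_norm.
  rewrite v0 normr0 mul0r scale0r; apply/cvgrPdist_le => d d0.
  have M1 : 0 < `|M| + 1 by rewrite ltr_wpDl.
  apply/nbhs_ballP; exists (d * rho / (`|M| + 1)) => /=.
    by rewrite divr_gt0// mulr_gt0.
  move=> x; rewrite -ball_normE/= sub0r normrN => xd [Px xr].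
  rewrite sub0r normrN normrZ ger0_norm; last by rewrite divr_ge0// ltW.
  have [->|x0] := eqVneq x 0; first by rewrite normr0 !mul0r ltW.
  have [_ QN _] := NP (S_nrm Px x0).
  rewrite (@le_trans _ _ (`|x| / rho * (`|M| + 1)))//.
    by rewrite ler_wpM2l// ?MQ// divr_ge0// ltW.
  rewrite -ler_pdivlMr// ler_pdivrMr// ltW// (lt_le_trans xd)//.
  by rewrite mulrAC.
apply: cvgZ; first by apply: cvgMr_tmp; exact: cnorm.
move=> B HB.
have /subspace_continuousP/(_ _ (S_nrm Pv v0))/(_ B HB) := Ncont.
rewrite /fmap /= => {}HB.
have {}HB : nbhs (nrm v) (fun s => S s -> B (N s)) := HB.
have cn : nrm x @[x --> v] --> nrm v.
  apply: cvgZ; last exact: cvg_id.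
  apply: cvgMl_tmp; apply: cvgV; first by rewrite normr_eq0.
  by apply: cvg_norm; exact: cvg_id.
suff : nbhs v (fun s => D s -> B (N (nrm s))) by [].
have cv : `|x| @[x --> v] --> `|v| by apply: cvg_norm; exact: cvg_id.
have nz : \forall x \near v, 0 < `|x| by apply: cvgr_gt cv _ _; rewrite normr_gt0.
near=> x => -[Px _].
have : S (nrm x) by apply: S_nrm => //; rewrite -normr_gt0; near: x.
by near: x; exact: cn _ HB.
Unshelve. all: by end_near. Qed.

Let fcont : {within D, continuous f}.
Proof.
apply/subspace_continuousP => v Dv.
have /subspace_continuousP/(_ v Dv) cW := Wcont.
apply: cvgZ; last exact: cW.
apply: cvgMl_tmp; apply: cvgV; first by rewrite gt_eqF// W_gt0.
exact: cvg_norm cW.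
Qed.

Lemma birkhoff_kellogg :
  exists lambda v, [/\ 0 < lambda, P v, `|v| = rho & v = lambda *: N v].
Proof.
have e0 : e != 0.
  apply: contraTneq elle => ->; rewrite -[X in ell X](scale0r (0 : V)) ellZ mul0r.
  by rewrite ltxx.
have [_ Qe _] := NP (S_nrm Pe e0).
(* [G] parametrises the image of [f] by the scaling factor, the weight [|v| / rho] and a point of
   [Q]. The lower bound [c'] keeps the scaling factor in a compact interval. *)
pose G (z : R * R * V) := z.1.1 *: (z.1.2 *: z.2 + (rho * (1 - z.1.2)) *: e).
have cptG : compact (G @` ((`[0, rho / c'] `*` `[0, 1]) `*` Q)).
  apply: continuous_compact; last first.
    by apply: compact_setX => //; apply: compact_setX; exact: segment_compact.
  apply: continuous_subspaceT => z.
  have c11 : z.1.1 @[z --> z] --> z.1.1.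
    by apply: (@cvg_comp _ _ _ fst fst); [exact: cvg_fst|exact: cvg_fst].
  have c12 : z.1.2 @[z --> z] --> z.1.2.
    by apply: (@cvg_comp _ _ _ fst snd); [exact: cvg_fst|exact: cvg_snd].
  apply: cvgZ => //; apply: cvgD.
    by apply: cvgZ => //; exact: cvg_snd.
  apply: cvgZr_tmp; apply: cvgMl_tmp; apply: cvgB => //; exact: cvg_cst.
have [||||v Dv fv] := @schauder R V D _ f _ _ _ cptG _ fcont.
- exists 0; split; last by rewrite normr0 ltW.
  by rewrite -(scale0r e); exact: PZ.
- move=> x y t [Px xr] [Py yr] t0 t1; have t1' : 0 <= 1 - t by rewrite subr_ge0.
  split; first by apply: PD; exact: PZ.
  rewrite (le_trans (ler_normD _ _))// !normrZ !ger0_norm//.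
  rewrite (@le_trans _ _ (t * rho + (1 - t) * rho))//.
    by rewrite lerD// ler_wpM2l.
  by rewrite -mulrDl addrC subrK mul1r.
- apply: closedI => //; apply: (@preimage_closed _ _ _ [set x | x <= rho]); last exact: closed_le.
  by move=> x _; apply: cvg_norm; exact: cvg_id.
- move=> v Dv; split.
    split; last by rewrite norm_f.
    by apply: PZ; [rewrite divr_ge0// ltW|exact: PW].
  have [Pv vr] := Dv.
  have tr : `|v| / rho \in `[0, 1].
    rewrite in_itv/=; apply/andP; split; first by rewrite divr_ge0// ltW.
    by rewrite ler_pdivrMr// mul1r.
  have sr : rho / `|W v| \in `[0, rho / c'].
    rewrite in_itv/=; apply/andP; split; first by rewrite divr_ge0// ltW.
    rewrite ler_pM2l// lef_pV2 ?posrE ?W_gt0//; exact: ellW.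
  have E : rho * (1 - `|v| / rho) = rho - `|v|.
    by rewrite mulrBr mulr1 mulrC divfK// gt_eqF.
  (* At 0 the weight vanishes, so any point of [Q] may stand in for [N (nrm v)]. *)
  have [v0|v0] := eqVneq v 0.
    exists (rho / `|W v|, `|v| / rho, N (nrm e)); first by [].
    by rewrite /G /= E /f /W v0 normr0 mul0r !scale0r.
  exists (rho / `|W v|, `|v| / rho, N (nrm v)); first split => //=.
    by have [] := NP (S_nrm Pv v0).
  by rewrite /G /= E.
have vr : `|v| = rho by rewrite -fv norm_f.
have nv : nrm v = v by rewrite /nrm vr divff ?scale1r// gt_eqF.
have Wv : W v = N v by rewrite /W nv vr divff ?gt_eqF// scale1r subrr scale0r addr0.
exists (rho / `|N v|), v; split => //; last by rewrite -Wv; exact/esym.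
  by rewrite divr_gt0// -Wv W_gt0.
by case: Dv.
Qed.

End birkhoff_kellogg.

(** * Compactness in C^1 *)

Section mean_value.
Context {R : realType}.
Implicit Types (a b x y t : R) (f : R -> R).

Lemma derivable_itv_is_derive a b f t : a < t -> t < b ->
  derivable_itv a b f t -> is_derive t 1 f (derive_itv a b f t).
Proof.
move=> at_ tb df.
have ab := lt_trans at_ tb.
have tab : t \in `[a, b] by rewrite in_itv/= !ltW.
have /cvgrPdist_le H : diffquot f t @ within `[a, b] t^' --> derive_itv a b f t.
  by rewrite /derive_itv ab.
have : h^-1 *: ((f \o shift t) (h *: 1) - f t) @[h --> 0^'] -->
    derive_itv a b f t.
  apply/cvgrPdist_le => e e0; have [d /= d0 Hd] := H e e0.
  exists (Num.min d (Num.min (t - a) (b - t))) => /=.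
    by rewrite !lt_min d0 !subr_gt0 at_ tb.
  move=> h /=; rewrite sub0r normrN !lt_min => /andP[hd /andP[ha hb]] h0.
  have := Hd (h + t); rewrite /= opprD addrCA subrr addr0 normrN hd.
  rewrite -subr_eq0 addrK h0 => /(_ isT isT); rewrite /diffquot addrK.
  rewrite [h *: 1]mulr1 mulrC; apply; rewrite in_itv/=.
  by move: ha hb; rewrite !ltr_norml; lra.
by move=> cv; apply: DeriveDef; [apply/cvg_ex; eexists; exact: cv|exact: cvg_lim].
Qed.

Lemma mean_value_itv a b x y f : a <= x -> x < y -> y <= b ->
    {within `[a, b], continuous f} ->
    (forall t, x < t -> t < y -> derivable_itv a b f t) ->
  exists2 c, x < c < y & f y - f x = derive_itv a b f c * (y - x).
Proof.
move=> ax xy yb cf df.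
have [||c cxy ->] := @MVT R f (derive_itv a b f) x y xy; last by exists c.
  move=> t; rewrite in_itv/= => /andP[xt ty].
  by apply: derivable_itv_is_derive; [lra|lra|exact: df].
apply: continuous_subspaceW cf => t /=; rewrite !in_itv/=; lra.
Qed.

(** Derivability is asked only strictly between [x] and [y], so either end may be a point where the
    derivative jumps. *)
Lemma lipschitz_itv a b x y f L : a <= x -> x <= y -> y <= b ->
    {within `[a, b], continuous f} ->
    (forall t, x < t -> t < y -> derivable_itv a b f t) ->
    (forall t, x < t -> t < y -> `|derive_itv a b f t| <= L) ->
  `|f y - f x| <= L * (y - x).
Proof.
move=> ax; rewrite le_eqVlt => /predU1P[-> *|xy yb cf df dL].
  by rewrite !subrr normr0 mulr0.
have [c /andP[xc cy] ->] := mean_value_itv ax xy yb cf df.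
rewrite normrM [X in _ * X]gtr0_norm ?subr_gt0// ler_wpM2r ?dL//.
by rewrite subr_ge0 ltW.
Qed.

Lemma C1_mean_value a b (u : C1 a b) s t : s \in `[a, b] -> t \in `[a, b] ->
  exists c, [/\ c \in `[a, b], `|c - t| <= `|s - t| &
    u s - u t = derive_itv a b u c * (s - t)].
Proof.
rewrite !in_itv/= => /andP[as_ sb] /andP[at_ tb].
have [du _] := C1P u; have cu := is_C1_continuous (C1P u).
have du' x y z : a <= x -> y <= b -> x < z -> z < y -> derivable_itv a b u z.
  by move=> *; apply: du; rewrite in_itv/=; lra.
have [st|ts|->] := ltgtP s t.
- have [c /andP[sc ct] E] := mean_value_itv as_ st tb cu (fun z => du' s t z as_ tb).
  exists c; split; first by rewrite in_itv/=; lra.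
    by rewrite !ltr0_norm; lra.
  by rewrite -opprB E -mulrN opprB.
- have [c /andP[tc cs] E] := mean_value_itv at_ ts sb cu (fun z => du' t s z at_ sb).
  exists c; split => //; first by rewrite in_itv/=; lra.
  by rewrite !gtr0_norm; lra.
by exists t; rewrite in_itv/= at_ tb !subrr mulr0.
Qed.

End mean_value.

Section C1_facts.
Context {R : realType} {a b : R}.
Implicit Types (u v : C1 a b) (t : R).

Lemma C1_fctD u v t : (u + v) t = u t + v t. Proof. by []. Qed.

Lemma C1_fctB u v t : (u - v) t = u t - v t. Proof. by []. Qed.

Lemma C1_fctZ (k : R) u t : (k *: u) t = k * u t. Proof. by []. Qed.

Lemma C1_le_norm u t : t \in `[a, b] -> `|u t| <= `|u|.
Proof.
by move=> tab; rewrite C1_normE le_max (supnorm_ge (is_C1_continuous (C1P u)) tab).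
Qed.

Lemma C1_derive_le_norm u t : t \in `[a, b] -> `|derive_itv a b u t| <= `|u|.
Proof.
by move=> tab; rewrite C1_normE le_max orbC; case: (C1P u) => _ cu; rewrite supnorm_ge.
Qed.

Lemma C1_norm_le u M : 0 <= M -> (forall t, t \in `[a, b] -> `|u t| <= M) ->
  (forall t, t \in `[a, b] -> `|derive_itv a b u t| <= M) -> `|u| <= M.
Proof. by move=> M0 H1 H2; rewrite C1_normE ge_max !supnorm_le. Qed.

Lemma C1_deriveD u v t : t \in `[a, b] ->
  derive_itv a b (u + v) t = derive_itv a b u t + derive_itv a b v t.
Proof.
move=> tab; have [du _] := C1P u; have [dv _] := C1P v.
by have := derive_lin 1 tab (du t tab) (dv t tab); rewrite scale1r mul1r.
Qed.

Lemma C1_derive0 t : t \in `[a, b] -> derive_itv a b (0 : C1 a b) t = 0.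
Proof.
move=> tab; have := C1_deriveD 0 0 tab; rewrite addr0 => /eqP.
by rewrite -subr_eq0 opprD addNKr oppr_eq0 => /eqP.
Qed.

Lemma C1_deriveZ (k : R) u t : t \in `[a, b] ->
  derive_itv a b (k *: u) t = k * derive_itv a b u t.
Proof.
move=> tab; have [du _] := C1P u; have [d0 _] := C1P (0 : C1 a b).
by have := derive_lin k tab (du t tab) (d0 t tab); rewrite C1_derive0// !addr0.
Qed.

Lemma C1_deriveB u v t : t \in `[a, b] ->
  derive_itv a b (u - v) t = derive_itv a b u t - derive_itv a b v t.
Proof. by move=> tab; rewrite C1_deriveD// -scaleN1r C1_deriveZ// mulN1r. Qed.

Lemma derive_itv_eq (f g : R -> R) t : {in `[a, b], f =1 g} -> t \in `[a, b] ->
  derive_itv a b f t = derive_itv a b g t.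
Proof.
move=> fg tab; rewrite /derive_itv; case: ifPn => // _; congr lim.
have sub (f1 f2 : R -> R) P : {in `[a, b], f1 =1 f2} ->
    (diffquot f1 t @ within `[a, b] t^') P ->
    (diffquot f2 t @ within `[a, b] t^') P.
  move=> f12 fP.
  have {}fP : t^' (fun s => s \in `[a, b] -> P (diffquot f1 t s)) := fP.
  suff : t^' (fun s => s \in `[a, b] -> P (diffquot f2 t s)) by [].
  apply: filterS fP => s fP sab.
  by have := fP sab; rewrite /diffquot !f12.
by apply/seteqP; split => P; apply: sub => // s sab; rewrite fg.
Qed.

Lemma derive_toC1 (f : R -> R) t : is_C1 a b f -> t \in `[a, b] ->
  derive_itv a b (toC1 a b f) t = derive_itv a b f t.
Proof. by move=> Cf tab; apply: derive_itv_eq => // s sab; rewrite toC1E. Qed.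

End C1_facts.

(** * An Arzela-Ascoli criterion in C^1 *)

Section C1_compactness.
Context {R : realType}.

(** A bounded closed interval is compact, and an ultrafilter converges to each of its cluster
    points. *)
Lemma ultra_bounded_cvg (T : Type) (F : set_system T) (phi : T -> R) (M : R) :
  UltraFilter F -> F [set x | `|phi x| <= M] -> cvg (phi x @[x --> F]).
Proof.
move=> FU FM; have [|l [lM cl]] := @segment_compact R (- M) M (phi x @[x --> F]) _.
  suff : F (fun x => phi x \in `[- M, M]) by [].
  by apply: filterS FM => x xM; rewrite in_itv/= -ler_norml.
apply/cvg_ex; exists l => B Bl.
have [//|FB] := in_ultra_setVsetC (phi @^-1` B) FU.
by have [z []] := cl (~` B) B FB Bl.
Qed.

Lemma lim_dist_le (T : Type) (F : set_system T) (phi psi : T -> R) (x y M : R) :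
  ProperFilter F -> phi z @[z --> F] --> x -> psi z @[z --> F] --> y ->
  F [set z | `|phi z - psi z| <= M] -> `|x - y| <= M.
Proof.
move=> PF cx cy FM.
have c : `|phi z - psi z| @[z --> F] --> `|x - y| by apply: cvg_norm; exact: cvgB.
exact: (closed_cvg [set z | z <= M] (@closed_le _ M) FM _ c).
Qed.

Lemma dist_transfer (x y z w m e : R) : `|x - y| <= m -> `|z - w| <= m ->
  m <= e / 3 -> `|x - z| <= e / 3 -> `|y - w| <= e.
Proof. by rewrite !ler_norml => /andP[? ?] /andP[? ?] ? /andP[? ?]; lra. Qed.

Context {a b : R}.
Variables (M : R) (m : R -> R -> R).
Hypothesis ab : a < b.
Hypothesis m0 : forall t, t \in `[a, b] ->
  m t u @[u --> within `[a, b] (nbhs t)] --> 0.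

(** Along an ultrafilter the values and the derivatives converge pointwise, to [v] and [w], and [w]
    inherits the modulus [m]. A difference quotient at [t] is a derivative at a nearby point, hence
    close to the derivative at [t] as measured by [m]; in the limit, [w] is the derivative of [v].
    Smallness of [m] is known only near each single [t], and compactness of the interval turns it
    into uniform convergence of the derivatives. *)
Lemma compact_C1_equicontinuous : compact [set u : C1 a b | `|u| <= M /\
  forall s t, s \in `[a, b] -> t \in `[a, b] ->
    `|derive_itv a b u s - derive_itv a b u t| <= m s t].
Proof.
set Q := [set u | _].
rewrite compact_ultra => F FU FQ.
have PF : ProperFilter F by exact: ultra_proper.
pose D := derive_itv a b.
have [M0|M0] := leP 0 M; last first.
  have [u [uM _]] := filter_ex FQ.
  by have := le_lt_trans (le_trans (normr_ge0 u) uM) M0; rewrite ltxx.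
pose ev t (u : C1 a b) : R := u t; pose de t (u : C1 a b) : R := D u t.
pose v t := lim (ev t @ F); pose w t := lim (de t @ F).
have cv t : t \in `[a, b] -> ev t @ F --> v t.
  move=> tab; apply: (@ultra_bounded_cvg _ F (ev t) M) => //.
  by apply: filterS FQ => u [uM _]; rewrite /= (le_trans (C1_le_norm u tab)).
have cw t : t \in `[a, b] -> de t @ F --> w t.
  move=> tab; apply: (@ultra_bounded_cvg _ F (de t) M) => //.
  by apply: filterS FQ => u [uM _]; rewrite /= (le_trans (C1_derive_le_norm u tab)).
have wm s t : s \in `[a, b] -> t \in `[a, b] -> `|w s - w t| <= m s t.
  move=> sab tab; apply: (lim_dist_le PF (cw s sab) (cw t tab)).
  by apply: filterS FQ => u [_]; exact.
have small t (e : R) : t \in `[a, b] -> 0 < e ->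
    exists2 d, 0 < d & forall s, s \in `[a, b] -> `|s - t| < d -> m t s <= e.
  move=> tab e0; have /cvgrPdist_le/(_ e e0)[d /= d0 Hd] := m0 tab.
  exists d => // s sab st; rewrite (le_trans (ler_norm _))//.
  by have := Hd s; rewrite /= distrC sub0r normrN; exact.
have vd t (e : R) : t \in `[a, b] -> 0 < e -> exists2 d, 0 < d & forall s,
    s \in `[a, b] -> s != t -> `|s - t| < d -> `|diffquot v t s - w t| <= e.
  move=> tab e0; have [d d0 Hd] := small t e tab e0; exists d => // s sab st sd.
  have c : (fun u : C1 a b => diffquot u t s) @ F --> diffquot v t s.
    by apply: cvgMr_tmp; apply: cvgB; exact: cv.
  apply: (lim_dist_le PF c (cw t tab)); apply: filterS FQ => u [_ um] /=.
  have [z [zab zt E]] := C1_mean_value u sab tab.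
  rewrite /diffquot E mulfK ?subr_eq0// distrC (le_trans (um _ _ tab zab))//.
  by apply: Hd => //; exact: le_lt_trans zt sd.
have vlim t : t \in `[a, b] -> diffquot v t @ within `[a, b] t^' --> w t.
  move=> tab; apply/cvgrPdist_le => e e0; have [d d0 Hd] := vd t e tab e0.
  by exists d => //= s /= ts st sab; rewrite distrC Hd// distrC.
have dv t : t \in `[a, b] -> derive_itv a b v t = w t.
  move=> tab; rewrite /derive_itv ab.
  by have ? := within_dnbhs_proper ab tab; exact/cvg_lim/vlim.
have C1v : is_C1 a b v.
  split=> [t tab|]; first by apply/cvg_ex; exists (w t); exact: vlim.
  apply/subspace_continuousP => t tab.
  suff : derive_itv a b v s @[s --> within `[a, b] (nbhs t)] --> w t.
    by rewrite -(dv t tab).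
  apply/cvgrPdist_le => e e0; have [d d0 Hd] := small t e tab e0.
  exists d => //= s /= ts sab; rewrite dv// (le_trans (wm _ _ tab sab))//.
  by rewrite Hd// distrC.
pose p := toC1 a b v.
have pv t : t \in `[a, b] -> p t = v t by exact: toC1E.
have dp t : t \in `[a, b] -> D p t = w t.
  by move=> tab; rewrite /D derive_toC1// dv.
exists p; split; first split.
- apply: C1_norm_le => // t tab; rewrite -[X in `|X|]subr0.
    rewrite pv//; apply: (lim_dist_le PF (cv t tab) (cvg_cst (0 : R))).
    by apply: filterS FQ => u [uM _]; rewrite /= subr0 (le_trans (C1_le_norm u tab)).
  rewrite -/(D _ _) dp//; apply: (lim_dist_le PF (cw t tab) (cvg_cst (0 : R))).
  by apply: filterS FQ => u [uM _]; rewrite /= subr0 (le_trans (C1_derive_le_norm u tab)).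
- by move=> s t sab tab; rewrite -/D !dp// wm.
have unif (e : R) : 0 < e ->
    \forall u \near F, forall t, t \in `[a, b] -> `|de t u - w t| <= e.
  move=> e0; have e3 : 0 < e / 3 by rewrite divr_gt0.
  have /compact_near_coveringP/(_ _ F
    (fun (u : C1 a b) t => t \in `[a, b] -> `|de t u - w t| <= e) PF) := @segment_compact R a b.
  move=> H; apply: filterS (H _); first by move=> u + t tab => /(_ t tab tab).
  move=> t tab; have [d d0 Hd] := small t _ tab e3.
  exists ([set s | `|s - t| < d], [set u | Q u /\ `|de t u - w t| <= e / 3]).
    split => /=; first by exists d => // s /=; rewrite distrC.
    near=> u; split; first by near: u.
    by near: u; move/cvgrPdist_le: (cw t tab) => /(_ _ e3); apply: filterS => u; rewrite distrC.
  move=> [s u] [/= sd [[_ um] ut]] sab.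
  exact: dist_transfer (um _ _ tab sab) (wm _ _ tab sab) (Hd s sab sd) ut.
have tri t : t \in `[a, b] -> 0 <= t - a <= b - a by rewrite in_itv/=; lra.
apply/cvgrPdist_le => e e0.
(* A function is bounded by its value at [a] plus [b - a] times a bound on its derivative. *)
pose L := 1 + (b - a); have L0 : 0 < L by rewrite ltr_wpDr// subr_ge0 ltW.
have eL : 0 < e / L / 2 by rewrite !divr_gt0.
have aab : a \in `[a, b] by rewrite in_itv/= lexx ltW.
near=> u.
have Hu : forall t, t \in `[a, b] -> `|de t u - w t| <= e / L / 2.
  by near: u; exact: unif.
have Ha : `|v a - u a| <= e / L / 2.
  by near: u; move/cvgrPdist_le: (cv a aab) => /(_ _ eL).
have DB t : t \in `[a, b] -> `|D (p - u) t| <= e / L / 2.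
  by move=> tab; rewrite /D C1_deriveB// -/D dp// distrC Hu.
have eLe : e / L / 2 * L <= e.
  rewrite mulrAC divfK ?gt_eqF// ler_pdivrMr// ler_peMr ?ler1n//; exact: ltW.
have eLe' : e / L / 2 <= e.
  by apply: le_trans eLe; rewrite ler_peMr ?(ltW eL)// /L lerDl subr_ge0 ltW.
apply: C1_norm_le; first exact: ltW.
- move=> t tab; have [c [cab _ E]] := C1_mean_value (p - u) tab aab.
  have -> : (p - u) t = (p - u) a + D (p - u) c * (t - a) by rewrite [RHS]addrC -E subrK.
  rewrite (le_trans (ler_normD _ _))// (le_trans _ eLe)//.
  rewrite [X in _ <= _ * X](_ : L = 1 + (b - a))// [leRHS]mulrDr mulr1 lerD//.
    by move: Ha; rewrite -(pv a aab).
  have /andP[ta0 tab'] := tri t tab.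
  rewrite normrM (ger0_norm ta0); apply: ler_pM => //; exact: DB.
- by move=> t tab; rewrite (le_trans (DB t tab)).
Unshelve. all: by end_near. Qed.

End C1_compactness.

(** * The history operator and the cone *)

Section history_facts.
Context {R : realType} {r : R}.
Hypothesis r0 : 0 < r.
Implicit Types (u v : C1 (- r) 1) (s theta : R).

Let r0' : - r < 0. Proof. by rewrite oppr_lt0. Qed.

Let shift_in s theta : s \in `[0, 1] -> theta \in `[- r, 0] ->
  s + theta \in `[- r, 1].
Proof. by rewrite !in_itv/=; lra. Qed.

Lemma derive_hist u s theta : s \in `[0, 1] -> theta \in `[- r, 0] ->
  derive_itv (- r) 0 (hist u s) theta = derive_itv (- r) 1 u (s + theta).
Proof.
move=> s01 th; have sub x := @shift_in s x s01.
rewrite derive_toC1//; last exact: is_C1_shift (C1P u).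
by have [du _] := C1P u; have [_ ->] := Defs.derive_shift r0' sub th (du _ (sub _ th)).
Qed.

Lemma hist_dist u v s : s \in `[0, 1] -> `|hist u s - hist v s| <= `|u - v|.
Proof.
move=> s01; apply: C1_norm_le => // th thr.
  rewrite C1_fctB !histE//.
  by rewrite -C1_fctB C1_le_norm// shift_in.
rewrite C1_deriveB// !derive_hist// -C1_deriveB ?shift_in//.
exact/C1_derive_le_norm/shift_in.
Qed.

Lemma hist_le_norm u s : s \in `[0, 1] -> `|hist u s| <= `|u|.
Proof.
move=> s01; apply: C1_norm_le => // th thr.
  by rewrite histE// C1_le_norm// shift_in.
by rewrite derive_hist// C1_derive_le_norm// shift_in.
Qed.

(** Compactness of the interval of [theta] lets one neighbourhood of [s] serve all of them. Used for
    a function and for its derivative, this makes the history continuous in time for the C^1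
    norm. *)
Lemma shift_uniform (f : R -> R) s (e : R) : {within `[- r, 1], continuous f} ->
    s \in `[0, 1] -> 0 < e ->
  \forall s' \near within `[0, 1] (nbhs s), forall theta,
    theta \in `[- r, 0] -> `|f (s' + theta) - f (s + theta)| <= e.
Proof.
move=> cf s01 e0; have e2 : 0 < e / 2 by rewrite divr_gt0.
have /compact_near_coveringP/(_ _ (within `[0, 1] (nbhs s))
  (fun s' th => th \in `[- r, 0] -> `|f (s' + th) - f (s + th)| <= e)) :=
  @segment_compact R (- r) 0.
move=> H; apply: filterS (H _ _); first by move=> s' + th thr => /(_ th thr thr).
move=> th thr; have /subspace_continuousP/(_ _ (shift_in s01 thr)) := cf.
move=> /cvgrPdist_le/(_ _ e2)[d /= d0 Hd].
have d2 : 0 < d / 2 by rewrite divr_gt0.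
exists (ball th (d / 2), [set s' | s' \in `[0, 1] /\ `|s - s'| < d / 2]).
  by split; [exact: nbhsx_ballx|exists (d / 2) => // s' ss' s'01].
move=> [th' s']; rewrite /ball/= => -[tht [s'01 ss']] th'r.
have lt1 : `|s + th - (s' + th')| < d.
  rewrite opprD addrACA (le_lt_trans (ler_normD _ _))// [ltRHS](splitr d).
  exact: ltrD.
have lt2 : `|s + th - (s + th')| < d.
  by rewrite opprD addrACA subrr add0r (lt_trans tht)// ltr_pdivrMr// ltr_pMr// ltr1n.
have := Hd _ lt1 (shift_in s'01 th'r); have := Hd _ lt2 (shift_in s01 th'r).
rewrite /from_subspace !ler_norml => /andP[? ?] /andP[? ?]; lra.
Qed.

Lemma hist_continuous u s : s \in `[0, 1] ->
  hist u s' @[s' --> within `[0, 1] (nbhs s)] --> hist u s.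
Proof.
move=> s01; apply/cvgrPdist_le => e e0.
have [_ cdu] := C1P u; have cu := is_C1_continuous (C1P u).
have s01P : \forall s' \near within `[0, 1] (nbhs s), s' \in `[0, 1].
  by exists 1 => /= [|s' _]; [exact: ltr01|exact].
near=> s'; have s'01 : s' \in `[0, 1] by near: s'.
apply: C1_norm_le => [|th thr|th thr]; first exact: ltW.
  rewrite C1_fctB !histE// distrC.
  by move: th thr; near: s'; exact: shift_uniform.
rewrite C1_deriveB// !derive_hist// distrC.
by move: th thr; near: s'; exact: shift_uniform.
Unshelve. all: by end_near. Qed.

End history_facts.

(** * The cone and the relative boundary of its balls *)

Section cone_facts.
Context {R : realType} {r : R}.
Hypothesis r0 : 0 < r.
Implicit Types (u v psi : C1 (- r) 1).

Lemma C1_ev_continuous (a b t : R) : t \in `[a, b] ->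
  continuous (fun u : C1 a b => u t : R).
Proof.
move=> tab u; have ? := nbhs_filter u; apply/cvgrPdist_lt => e e0.
apply: filterS (nbhsx_ballx (u : C1 a b) e e0) => v.
by rewrite -ball_normE/= => uv; apply: le_lt_trans uv; rewrite -C1_fctB C1_le_norm.
Qed.

Lemma C1_derive_continuous (a b t : R) : t \in `[a, b] ->
  continuous (fun u : C1 a b => derive_itv a b u t : R).
Proof.
move=> tab u; have ? := nbhs_filter u; apply/cvgrPdist_lt => e e0.
apply: filterS (nbhsx_ballx (u : C1 a b) e e0) => v.
rewrite -ball_normE/= => uv; apply: le_lt_trans uv; rewrite -C1_deriveB//.
exact: C1_derive_le_norm.
Qed.

Let sub0 t : t \in `[- r, 0] -> t \in `[- r, 1].
Proof. by rewrite !in_itv/=; lra. Qed.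

Let sub1 t : t \in `[0, 1] -> t \in `[- r, 1].
Proof. by rewrite !in_itv/=; have := r0; lra. Qed.

Lemma closed_K0 : closed (K0 : set (C1 (- r) 1)).
Proof.
have -> : (K0 : set (C1 (- r) 1)) =
    (\bigcap_(t in [set t | t \in `[- r, 1]]) [set u : C1 (- r) 1 | 0 <= u t]) `&`
    (\bigcap_(t in [set t | t \in `[- r, 0]])
       ([set u : C1 (- r) 1 | u t = 0] `&`
        [set u : C1 (- r) 1 | derive_itv (- r) 1 u t = 0])).
  apply/seteqP; split=> u [H1 H2]; split => // t tr.
apply: closedI; apply: closed_bigI => t /= tr; last apply: closedI.
- apply: (@preimage_closed _ _ _ [set x : R | 0 <= x]); last exact: closed_ge.
  by move=> u _; exact: C1_ev_continuous.
- apply: (@preimage_closed _ _ _ [set x : R | x = 0]); last exact: closed_eq.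
  by move=> u _; apply: C1_ev_continuous; exact: sub0.
- apply: (@preimage_closed _ _ (fun u : C1 (- r) 1 => derive_itv (- r) 1 u t : R)
    [set x : R | x = 0]); last exact: closed_eq.
  by move=> u _; apply: C1_derive_continuous; exact: sub0.
Qed.

Lemma K0D u v : K0 u -> K0 v -> K0 (u + v).
Proof.
move=> [u0 u1] [v0 v1]; split=> t tr; first by rewrite C1_fctD addr_ge0 ?u0 ?v0.
have [ut Dut] := u1 t tr; have [vt Dvt] := v1 t tr.
rewrite C1_deriveD ?sub0// Dut Dvt addr0; split => //.
by rewrite C1_fctD ut vt addr0.
Qed.

Lemma K0Z k u : 0 <= k -> K0 u -> K0 (k *: u).
Proof.
move=> k0 [u0 u1]; split=> t tr; first by rewrite C1_fctZ mulr_ge0 ?u0.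
have [ut Dut] := u1 t tr; rewrite C1_deriveZ ?sub0// Dut mulr0; split => //.
by rewrite C1_fctZ ut mulr0.
Qed.

(** Functions of the cone vanish on [[-r, 0]] together with their derivative, and at 0 the
    derivatives relative to [[0, 1]] and to [[-r, 1]] agree. So the balls of the statement, measured
    on [[0, 1]], are balls for the norm of the whole space. *)
Lemma K0_normE u : K0 u -> C1norm 0 1 u = `|u|.
Proof.
move=> [_ u1]; have [du cdu] := C1P u; have cu := is_C1_continuous (C1P u).
have sub t : t \in `[0, 1] -> 0 + t \in `[- r, 1] by rewrite add0r; exact: sub1.
have E : (fun s => u (0 + s)) = u :> (R -> R) by apply/funext => s; rewrite add0r.
have dE t : t \in `[0, 1] -> derive_itv 0 1 u t = derive_itv (- r) 1 u t.
  move=> t01; have [_] := Defs.derive_shift ltr01 sub t01 (du _ (sub t t01)).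
  by rewrite E add0r.
have C01 : is_C1 0 1 u.
  by rewrite -E; exact: is_C1_shift ltr01 sub (C1P u).
apply/eqP; rewrite eq_le; apply/andP; split.
  rewrite ge_max !supnorm_le// => t t01; first by rewrite dE// C1_derive_le_norm// sub1.
  by rewrite C1_le_norm// sub1.
have M0 : 0 <= C1norm 0 1 u by rewrite le_max supnorm_ge0.
have cut t : t \in `[- r, 1] -> t \in `[- r, 0] \/ t \in `[0, 1].
  by rewrite !in_itv/= => /andP[-> ->]; case: (leP t 0) => t0; [left|right; rewrite ltW].
apply: C1_norm_le => // t /cut[tr|t01].
- by rewrite (u1 t tr).1 normr0.
- by rewrite le_max supnorm_ge//; exact: is_C1_continuous.
- by rewrite (u1 t tr).2 normr0.
- by rewrite le_max -dE// [X in _ || X]supnorm_ge ?orbT//; case: C01.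
Qed.

(** Shrinking [v] to [(1 - q) *: v] stays in the cone and enters the open ball. The second term of
    the minimum [q] keeps the displacement below [d]. *)
Lemma K_closure_ball psi rho v : K0 v -> 0 < rho -> `|v| <= rho ->
  K_closure psi rho (psi + v).
Proof.
move=> Kv rho0 vr B.
have Kp : K_shift psi (psi + v) by exists v.
move=> HB; have {}HB : within (K_shift psi) (nbhs (psi + v)) B.
  by rewrite (nbhs_subspace_in Kp).
have /nbhs_ballP[d /= d0 Hd] : nbhs (psi + v) (fun x => K_shift psi x -> B x).
  exact: HB.
pose q := Num.min (1 / 2) (d / 2 / rho).
have q0 : 0 < q by rewrite lt_min !divr_gt0.
have q1 : q <= 1 / 2 by rewrite ge_min lexx.
have K1 : K0 ((1 - q) *: v) by apply: K0Z => //; lra.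
exists (psi + (1 - q) *: v); split.
  exists ((1 - q) *: v) => //; split => //; rewrite K0_normE// normrZ ger0_norm; last lra.
  rewrite (@le_lt_trans _ _ ((1 - q) * rho))//; first by rewrite ler_wpM2l//; lra.
  by rewrite gtr_pMl//; lra.
apply: Hd; last by exists ((1 - q) *: v).
rewrite -ball_normE/= opprD addrACA subrr add0r scalerBl scale1r opprB addrC subrK.
rewrite normrZ gtr0_norm// (@le_lt_trans _ _ (d / 2 / rho * rho))//.
  by apply: ler_pM; rewrite ?(ltW q0)// ge_min lexx orbT.
by rewrite divfK ?gt_eqF// ltr_pdivrMr// ltr_pMr// ltr1n.
Qed.

(** Stretching [v] to [(1 + q) *: v] leaves the ball but not the cone, so [psi + v] is not
    relatively interior. This inclusion makes the bounds assumed on the boundary available on the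
    sphere and places the solution on the boundary. *)
Lemma K_boundary_sphere psi rho v : K0 v -> 0 < rho -> `|v| = rho ->
  K_boundary psi rho (psi + v).
Proof.
move=> Kv rho0 vr; split; first by apply: K_closure_ball; rewrite ?vr.
have Kp : K_shift psi (psi + v) by exists v.
move=> H.
have {}H : within (K_shift psi) (nbhs (psi + v)) (K_ball psi rho).
  by rewrite (nbhs_subspace_in Kp).
have /nbhs_ballP[d /= d0 Hd] :
    nbhs (psi + v) (fun x => K_shift psi x -> K_ball psi rho x).
  exact: H.
pose q := d / 2 / rho; have q0 : 0 < q by rewrite !divr_gt0.
have K1 : K0 ((1 + q) *: v) by apply: K0Z => //; lra.
have Hb : ball (psi + v) d (psi + (1 + q) *: v).
  rewrite -ball_normE/= opprD addrACA subrr add0r scalerDl scale1r opprD addNKr.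
  by rewrite normrN normrZ gtr0_norm// vr divfK ?gt_eqF// ltr_pdivrMr// ltr_pMr// ltr1n.
have [u [Ku uq] /addrI E] := Hd _ Hb (ex_intro2 _ _ _ K1 erefl).
move: uq; rewrite E K0_normE// normrZ gtr0_norm; last lra.
by rewrite vr ltNge ler_peMl//; lra.
Qed.

End cone_facts.

(** * Sections of Lebesgue measurable sets of the plane *)

Section hull.
Local Open Scope ereal_scope.
Context d (T : measurableType d) (R : realType).
Variable mu : {measure set T -> \bar R}.

(** The hull is the intersection of countable measurable covers whose total measure exceeds the
    outer measure by less than [1 / (n + 1)]. *)
Lemma mu_ext_hull (E : set T) : mu_ext mu E < +oo ->
  exists F : set T, [/\ measurable F, E `<=` F & mu F = mu_ext mu E].
Proof.
move=> Eoo.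
have inv0 n : (0 < n.+1%:R^-1 :> R)%R by rewrite invr_gt0.
have coverE n : exists2 A, @measurable_cover _ T E A &
    \sum_(0 <= k <oo) mu (A k) < mu_ext mu E + n.+1%:R^-1%:E.
  have : mu_ext mu E \is a fin_num by rewrite ge0_fin_numE// mu_ext_ge0.
  by move/lb_ereal_inf_adherent => /(_ _ (inv0 n))[_/= [A EA] <-] ?; exists A.
pose A n := sval (cid2 (coverE n)).
have AE n : measurable_cover E (A n) by rewrite /A; case: cid2.
have muA n : \sum_(0 <= k <oo) mu (A n k) < mu_ext mu E + n.+1%:R^-1%:E.
  by rewrite /A; case: cid2.
pose F n := \bigcup_m A n m.
have mF n : measurable (F n) by apply: bigcupT_measurable => i; case: (AE n).
have mFF : measurable (\bigcap_n F n) by exact: bigcapT_measurable.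
have EF : E `<=` \bigcap_n F n by apply: sub_bigcap => n _; case: (AE n).
exists (\bigcap_n F n); split => //.
apply/eqP; rewrite eq_le; apply/andP; split; last first.
  by rewrite -(measurable_mu_extE mu mFF); exact: le_mu_ext.
apply/lee_addgt0Pr => e e0.
have [n ne] : exists n, (n.+1%:R^-1 <= e)%R.
  near \oo => n; exists n; near: n; apply: filterS (near_infty_natSinv_lt (PosNum e0)) => n.
  exact: ltW.
apply: (@le_trans _ _ (mu (F n))).
  by apply: le_measure; [exact: mem_set|exact: mem_set|exact: bigcap_inf].
apply: (@le_trans _ _ (\sum_(0 <= k <oo) mu (A n k))).
  by apply: measure_sigma_subadditive => // i; case: (AE n).
by rewrite (le_trans (ltW (muA n)))// leeD2l// lee_fin.
Unshelve. all: by end_near. Qed.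

End hull.

Section almost_everywhere.
Context {R : realType}.
Implicit Types P Q : R -> Prop.

Let lebF : Filter (almost_everywhere (leb R)) := ae_filter_ringOfSetsType (leb R).

Let lamF : Filter (almost_everywhere (@lebesgue_measure R)) :=
  ae_filter_ringOfSetsType (@lebesgue_measure R).

Lemma lam_ae P Q : (forall t, P t -> Q t) ->
  {ae @lebesgue_measure R, forall t, P t} -> {ae @lebesgue_measure R, forall t, Q t}.
Proof. by move=> PQ; apply: (@filterS _ _ lamF). Qed.

Lemma leb_ae P Q : (forall t, P t -> Q t) ->
  {ae leb R, forall t, P t} -> {ae leb R, forall t, Q t}.
Proof. by move=> PQ; apply: (@filterS _ _ lebF). Qed.

Lemma leb_ae2 P Q (S : R -> Prop) : (forall t, P t -> Q t -> S t) ->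
  {ae leb R, forall t, P t} -> {ae leb R, forall t, Q t} ->
  {ae leb R, forall t, S t}.
Proof. by move=> PQS; apply: (@filterS2 _ _ lebF). Qed.

Lemma leb_ae_all (P : nat -> R -> Prop) : (forall n, {ae leb R, forall t, P n t}) ->
  {ae leb R, forall t, forall n, P n t}.
Proof. exact: ae_foralln. Qed.

Lemma leb_ae_true P : (forall t, P t) -> {ae leb R, forall t, P t}.
Proof. by move=> HP; apply: (@filterE _ _ lebF). Qed.

End almost_everywhere.

Section lebesgue_sections.
Local Open Scope ereal_scope.
Context {R : realType}.
Notation lam := (@lebesgue_measure R).
Notation lam2 := (lam \x lam).

Lemma measurable_leb (A : set R) :
  measurable (A : set (measurableTypeR R)) -> measurable (A : set (lebesgueTypeR R)).
Proof. exact: sub_caratheodory. Qed.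

Lemma negligible_leb (A : set R) :
  lam.-negligible A -> (leb R).-negligible A.
Proof. by move=> [B [mB B0 AB]]; exists B; split => //; exact: measurable_leb. Qed.

Lemma leb_negligible_measurable (A : set R) :
  (leb R).-negligible A -> measurable (A : set (lebesgueTypeR R)).
Proof. exact: completed_lebesgue_measure_is_complete. Qed.

(** The product measure is the integral of the measures of the sections, and a nonnegative function
    with zero integral vanishes almost everywhere. *)
Lemma ae_null_section (F : set (R * R)) :
    measurable (F : set (measurableTypeR R * measurableTypeR R)) ->
  lam2 F = 0 -> {ae lam, forall t, lam (xsection F t) = 0}.
Proof.
move=> mF F0.
have mx := measurable_fun_xsection lam mF.
have : \int[lam]_x `|(lam \o xsection F) x| = 0.
  by rewrite -[RHS]F0; apply: eq_integral => x _; rewrite gee0_abs.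
move=> /(ae_eq_integral_abs lam measurableT mx).
by apply: filterS => t; exact.
Qed.

(** [E] is a Borel hull [F] minus a set of outer measure zero, which has a null Borel hull [G].
    Almost every section of [G] is null, so the section of [E] is a Borel set minus a null set,
    measurable by completeness. Finiteness of the measure of [D] allows the subtraction showing that
    [F] exceeds [E] by outer measure zero. *)
Lemma ae_measurable_section (E D : set (R * R)) :
    measurable (D : set (measurableTypeR R * measurableTypeR R)) ->
    lam2 D < +oo -> E `<=` D ->
    measurable (E : set (lebesgueTypeR2 R)) ->
  {ae lam, forall t, measurable (xsection E t : set (lebesgueTypeR R))}.
Proof.
move=> mD Doo ED mE.
have Eoo : mu_ext lam2 E < +oo.
  by rewrite (le_lt_trans (le_mu_ext lam2 ED))// measurable_mu_extE.
have [F [mF EF FE]] := mu_ext_hull Eoo.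
have FDE : mu_ext lam2 (F `\` E) = 0.
  have : mu_ext lam2 F = mu_ext lam2 (F `&` E) + mu_ext lam2 (F `&` ~` E) := mE F.
  rewrite measurable_mu_extE// setIidr// FE.
  have fE : mu_ext lam2 E \is a fin_num by rewrite ge0_fin_numE// mu_ext_ge0.
  by move=> /(congr1 (fun x => x - mu_ext lam2 E)); rewrite subee// addeAC subee// add0e.
have [|G [mG NG G0]] := @mu_ext_hull _ _ _ lam2 (F `\` E).
  by rewrite FDE ltry.
rewrite FDE in G0.
move: (ae_null_section mG G0); apply: lam_ae => t Gt.
have -> : xsection E t = xsection F t `\` xsection (F `\` E) t.
  apply/seteqP; split=> s.
    by move=> /set_mem Es; split; [apply/mem_set; exact: EF|move=> /set_mem[]].
  move=> [/set_mem Fs nE]; apply/mem_set; apply: contrapT => Es.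
  by apply: nE; apply/mem_set.
apply: measurableD; first by apply: measurable_leb; exact: measurable_xsection.
apply: leb_negligible_measurable; apply: negligible_leb.
exists (xsection G t); split => //; first exact: measurable_xsection.
by move=> s /set_mem Gs; apply/mem_set; exact: NG.
Qed.

(** Rational rays suffice, so for sections only countably many null sets of parameters have to be
    excluded. *)
Lemma measurable_fun_rat_rays d (T : measurableType d) (D : set T) (f : T -> R) :
    measurable D ->
    (forall q : rat, measurable (D `&` f @^-1` `]ratr q, +oo[)) ->
  measurable_fun D f.
Proof.
move=> mD mf; apply: (measurability _ (RGenOInfty.measurableE R)).
move=> _ [_ [x ->] <-].
have -> : D `&` f @^-1` `]x, +oo[ =
    \bigcup_(q in [set q : rat | (x < ratr q)%R]) (D `&` f @^-1` `]ratr q, +oo[).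
  apply/seteqP; split=> [t [Dt]|t [q xq [Dt]]].
    rewrite /= in_itv/= andbT => /rat_in_itvoo[q]; rewrite in_itv/= => /andP[xq qf].
    by exists q => //; split => //; rewrite /= in_itv/= qf.
  rewrite /= in_itv/= andbT => qf; split => //.
  by rewrite /= in_itv/= andbT (lt_trans _ qf).
rewrite bigcup_mkcond; apply: bigcupT_measurable_rat => q.
by case: ifPn => _; [exact: mf|exact: measurable0].
Qed.

Lemma ae_leb_measurable_section (a b c e : R) (f : R -> R -> R) :
    leb2_measurable (`[a, b] `*` `[c, e]) (fun z => f z.1 z.2) ->
  {ae lam, forall t, t \in `[a, b] -> leb_measurable `[c, e] (f t)}.
Proof.
move=> mf; pose D : set (R * R) := `[a, b] `*` `[c, e].
have mD : measurable (D : set (measurableTypeR R * measurableTypeR R)).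
  by apply: measurableX; exact: measurable_itv.
have Doo : lam2 D < +oo.
  have oo (x y : R) : lam `[x, y] < +oo.
    by rewrite lebesgue_measure_itv/=; case: ifP => _; rewrite -?EFinB ltry.
  rewrite product_measure1E; try exact: measurable_itv.
  apply: lte_mul_pinfty; [exact: measure_ge0| |exact: oo].
  by rewrite ge0_fin_numE; [exact: oo|exact: measure_ge0].
pose E (q : rat) := D `&` (fun z => f z.1 z.2) @^-1` `]ratr q, +oo[.
have mE q : measurable (E q : set (lebesgueTypeR2 R)).
  apply: mf; last exact: measurable_itv.
  exact: (caratheodory_measurable_mu_ext lam2 mD).
pose q_ (n : nat) : rat := odflt 0%R (choice.unpickle n).
have H n : {ae lam, forall t,
    measurable (xsection (E (q_ n)) t : set (lebesgueTypeR R))}.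
  by apply: ae_measurable_section mD Doo _ (mE _) => z [].
move: (ae_foralln H); apply: lam_ae => t Ht tab.
apply: measurable_fun_rat_rays => [|q].
  by apply: measurable_leb; exact: measurable_itv.
have := Ht (choice.pickle q); rewrite /q_ choice.pickleK /=.
suff -> : xsection (E q) t = `[c, e] `&` f t @^-1` `]ratr q, +oo[ by [].
apply/seteqP; split=> s; first by move=> /set_mem[[]].
by move=> [sce fs]; apply/mem_set.
Qed.

End lebesgue_sections.

(** * Lebesgue integrals *)

Section sequential_limits.
Context {R : realType} {V W : normedModType R}.

(** Dominated convergence speaks of sequences. If the limit failed, bad points at distance less than
    [1 / (n + 1)] from [p] would form a sequence contradicting the assumption. *)
Lemma cvg_within_seq (D : set V) (p : V) (f : V -> W) (l : W) :
    (forall x : nat -> V, (forall n, D (x n)) -> x n @[n --> \oo] --> p ->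
       f (x n) @[n --> \oo] --> l) ->
  f x @[x --> within D (nbhs p)] --> l.
Proof.
move=> H; apply/cvgrPdist_lt => e e0; apply: contrapT => nH.
have bad n : exists x, [/\ D x, `|p - x| < n.+1%:R^-1 & e <= `|l - f x|].
  apply: contrapT => nx; apply: nH.
  have n0 : 0 < n.+1%:R^-1 :> R by rewrite invr_gt0.
  suff : nbhs p (fun x => D x -> `|l - f x| < e) by [].
  apply: filterS (nbhsx_ballx p _ n0) => x px Dx; rewrite ltNge; apply/negP => le.
  by apply: nx; exists x; split => //; move: px; rewrite -ball_normE.
pose x n := sval (cid (bad n)).
have Hx n : [/\ D (x n), `|p - x n| < n.+1%:R^-1 & e <= `|l - f (x n)|].
  by rewrite /x; case: cid.
have xp : x n @[n --> \oo] --> p.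
  apply/cvgrPdist_lt => d d0; near=> n; have [_ xn _] := Hx n.
  by rewrite (lt_trans xn)//; near: n; exact: (near_infty_natSinv_lt (PosNum d0)).
have Dx n : D (x n) by case: (Hx n).
have /cvgrPdist_lt/(_ e e0)[N _ HN] := H x Dx xp.
by have := HN N (leqnn N); rewrite /= ltNge; case: (Hx N) => _ _ ->.
Unshelve. all: by end_near. Qed.

Lemma within_seq_cvg (D : set V) (p : V) (f : V -> W) (l : W) (x : nat -> V) :
    f u @[u --> within D (nbhs p)] --> l ->
    (forall n, D (x n)) -> x n @[n --> \oo] --> p ->
  f (x n) @[n --> \oo] --> l.
Proof.
move=> fl Dx xp P /fl H.
have {}H : nbhs p (fun u => D u -> P (f u)) := H.
have {}H : \oo (fun n => D (x n) -> P (f (x n))) := xp _ H.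
suff : \oo (fun n => P (f (x n))) by [].
by apply: filterS H => n Hn; exact: Hn (Dx n).
Qed.

End sequential_limits.

Lemma within_dnbhsE {R : realType} (A : set R) (t : R) :
  within A t^' = within (A `\ t) (nbhs t).
Proof.
apply/seteqP; split=> P H.
  have {}H : nbhs t (fun u => u != t -> A u -> P u) := H.
  suff : nbhs t (fun u => (A `\ t) u -> P u) by [].
  by apply: filterS H => u Hu [Au /eqP ut]; exact: Hu.
have {}H : nbhs t (fun u => (A `\ t) u -> P u) := H.
suff : nbhs t (fun u => u != t -> A u -> P u) by [].
by apply: filterS H => u Hu ut Au; apply: Hu; split => //; exact/eqP.
Qed.

(** * Almost everywhere comparison and dominated convergence *)

Section lebesgue_integral.
Context {R : realType}.
Variable D : set R.
Hypothesis mD : measurable (D : set (lebesgueTypeR R)).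
Implicit Types (f G : R -> R).

Notation integ f := ((leb R).-integrable D (EFin \o f)).
Notation J f := (\int[leb R]_(s in D) f s).

Lemma leb_measurableE f :
  leb_measurable D f <-> @measurable_fun _ _ (lebesgueTypeR R) _ D (EFin \o f).
Proof. by split=> mf; exact/measurable_EFinP. Qed.

Lemma leb_measurable_norm f : leb_measurable D f ->
  leb_measurable D (fun s => `|f s|).
Proof. exact: (measurableT_comp (@normr_measurable R setT)). Qed.

Lemma leb_measurable_ae_eq f G : {ae leb R, forall s, D s -> f s = G s} ->
  leb_measurable D f -> leb_measurable D G.
Proof.
move=> fG /leb_measurableE mf; apply/leb_measurableE; apply: ae_measurable_fun mf.
  exact: completed_lebesgue_measure_is_complete.
by apply: leb_ae fG => s fG Ds; rewrite /= fG.
Qed.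

(** By completeness the exceptional set is measurable, and multiplying by the indicator of its
    complement turns the convergence into convergence at every point of [D]. *)
Lemma leb_measurable_ae_cvg (h : nat -> R -> R) f :
    (forall n, leb_measurable D (h n)) ->
    {ae leb R, forall s, D s -> h n s @[n --> \oo] --> f s} ->
  leb_measurable D f.
Proof.
move=> mh /= hf.
have mB : measurable ((~` [set s | D s -> h n s @[n --> \oo] --> f s]) :
    set (lebesgueTypeR R)) by apply: leb_negligible_measurable; exact: hf.
set B := ~` _ in mB hf.
have : leb_measurable D (fun s => f s * \1_(~` B) s).
  apply: (@measurable_fun_cvg _ (lebesgueTypeR R) R D
    (fun n s => h n s * \1_(~` B) s)).
    move=> n; apply: measurable_funM; first exact: mh.
    by apply: measurable_indic; exact: measurableC.
  move=> s Ds; rewrite indicE; have [/set_mem|] := boolP (s \in ~` B).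
    rewrite /B setCK => /(_ Ds) c /=.
    by rewrite mulr1; under eq_fun do rewrite mulr1.
  by move=> _ /=; rewrite mulr0; under eq_fun do rewrite mulr0; exact: cvg_cst.
apply: leb_measurable_ae_eq.
have : {ae leb R, forall s, (~` B) s} by rewrite /B setCK.
by apply: leb_ae => s nB _; rewrite indicE mem_set// mulr1.
Qed.

Lemma leb_integrable_le f G : leb_measurable D f -> integ G ->
  {ae leb R, forall s, D s -> `|f s| <= G s} -> integ f.
Proof.
move=> mf iG fG; have mfE := (leb_measurableE f).1 mf.
apply/integrableP; split => //.
have [mG /= Goo] := integrableP _ _ _ iG.
apply: le_lt_trans Goo; apply: ae_ge0_le_integral.
- exact: mD.
- by move=> s _; rewrite lee_fin normr_ge0.
- exact/leb_measurableE/leb_measurable_norm.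
- by move=> s _; rewrite lee_fin normr_ge0.
- exact/leb_measurableE/leb_measurable_norm/leb_measurableE.
- by apply: leb_ae fG => s fG Ds; rewrite /= lee_fin (le_trans (fG Ds))// ler_norm.
Qed.

Lemma ae_eq_leb_integral f G : leb_measurable D f ->
  {ae leb R, forall s, D s -> f s = G s} -> J f = J G.
Proof.
move=> mf fG; have mG := leb_measurable_ae_eq fG mf.
congr fine; apply: ae_eq_integral; [exact: mD|exact/leb_measurableE|
  exact/leb_measurableE|].
by apply: leb_ae fG => s fG Ds; rewrite /= fG.
Qed.

(** [f] agrees almost everywhere with the minimum of [f] and [G], which is at most [G]
    everywhere. *)
Lemma ae_le_leb_integral f G : integ f -> integ G ->
  {ae leb R, forall s, D s -> f s <= G s} -> J f <= J G.
Proof.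
move=> If iG fG.
have mf : leb_measurable D f by apply/leb_measurableE; case/integrableP: If.
have mG : leb_measurable D G by apply/leb_measurableE; case/integrableP: iG.
have E : {ae leb R, forall s, D s -> f s = Num.min (f s) (G s)}.
  by apply: leb_ae fG => s fG Ds; rewrite min_l// fG.
rewrite (ae_eq_leb_integral mf E); apply: le_Rintegral => //.
  apply: leb_integrable_le (leb_measurable_ae_eq E mf) (integrable_norm If) _.
  by apply: leb_ae E => s E Ds; rewrite -E.
by move=> s _; rewrite ge_min lexx orbT.
Qed.

Lemma leb_integral_norm_le f G : leb_measurable D f -> integ G ->
  {ae leb R, forall s, D s -> `|f s| <= G s} -> `|J f| <= J G.
Proof.
move=> mf iG fG; have If := leb_integrable_le mf iG fG.
apply: le_trans (le_normr_Rintegral mD If) _; apply: ae_le_leb_integral => //.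
by have := integrable_norm If.
Qed.

Lemma leb_integral_cvg (h : nat -> R -> R) f G :
    (forall n, leb_measurable D (h n)) -> integ G ->
    {ae leb R, forall s, D s -> h n s @[n --> \oo] --> f s} ->
    {ae leb R, forall s, forall n, D s -> `|h n s| <= G s} ->
  J (h n) @[n --> \oo] --> J f.
Proof.
move=> mh iG hf hG.
have mf := leb_measurable_ae_cvg mh hf.
have [|||||If _ c] := @dominated_convergence _ (lebesgueTypeR R) R (leb R) D mD
  (fun n => EFin \o h n) (EFin \o f) (EFin \o G).
- by move=> n; exact/leb_measurableE.
- exact/leb_measurableE.
- by apply: leb_ae hf => s hf Ds; apply: cvg_EFin; [exact: nearW|exact: hf].
- exact: iG.
- by apply: leb_ae hG => s hG n Ds; rewrite /= lee_fin hG.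
apply: fine_cvg; rewrite fineK; first exact: c.
exact: integrable_fin_num.
Qed.

End lebesgue_integral.

(** * The integral operator *)

Section dense_points.
Context {R : realType}.
Implicit Types (a b t e : R).

(** The rationals, enumerated and clamped to [[a, b]]; a number that codes no rational is read as
    0. *)
Definition dense_seq a b (n : nat) : R :=
  Num.max a (Num.min b (ratr (odflt 0 (choice.unpickle n) : rat))).

Lemma dense_seq_in a b n : a <= b -> dense_seq a b n \in `[a, b].
Proof. by move=> ab; rewrite in_itv/= le_max lexx/= ge_max ab ge_min lexx. Qed.

Lemma dense_seqP a b t e : t \in `[a, b] -> 0 < e ->
  exists n, `|t - dense_seq a b n| < e.
Proof.
rewrite in_itv/= => /andP[at_ tb] e0.
have te : t < t + e by rewrite ltrDl.
have [q] := rat_in_itvoo te; rewrite in_itv/= => /andP[tq qe].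
exists (choice.pickle q); rewrite /dense_seq choice.pickleK /=.
have H1 : t <= Num.min b (ratr q) by rewrite le_min tb ltW.
rewrite max_r; last exact: le_trans H1.
rewrite distrC ger0_norm ?subr_ge0// ltrBlDl.
by rewrite (le_lt_trans _ qe)// ge_min lexx orbT.
Qed.

Lemma ae_exists_itv a b (P : R -> Prop) : a < b ->
  {ae @lebesgue_measure R, forall t, P t} -> exists2 t, t \in `[a, b] & P t.
Proof.
move=> ab [N [mN N0 PN]]; apply: contrapT => nP.
have sub : `[a, b]%classic `<=` N.
  by move=> t tab; apply: PN => Pt; apply: nP; exists t.
have : (@lebesgue_measure R `[a, b] <= @lebesgue_measure R N)%E.
  by apply: le_measure => //; apply: mem_set => //; exact: measurable_itv.
rewrite N0 lebesgue_measure_itv/= lte_fin ab -EFinB lee_fin subr_le0.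
by rewrite leNgt ab.
Qed.

Lemma ae_neq t : {ae leb R, forall s, s != t}.
Proof.
have : (@lebesgue_measure R).-negligible [set t].
  by exists [set t]; split => //; exact: lebesgue_measure_set1.
move=> /negligible_leb [N [mN N0 tN]]; exists N; split => // s /= /negP.
by rewrite negbK => /eqP ->; exact: tN.
Qed.

Lemma cvg_withinW (A B : set R) t (f : R -> R) (l : R) : A `<=` B ->
  f u @[u --> within B (nbhs t)] --> l -> f u @[u --> within A (nbhs t)] --> l.
Proof.
move=> AB fl P /fl H.
have {}H : nbhs t (fun u => B u -> P (f u)) := H.
suff : nbhs t (fun u => A u -> P (f u)) by [].
by apply: filterS H => u Hu /AB/Hu.
Qed.

Lemma le_dense_seq a b t (f : R -> R) (M : R) : t \in `[a, b] ->
    f u @[u --> within `[a, b] (nbhs t)] --> f t ->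
    (forall n, `|f (dense_seq a b n)| <= M) -> `|f t| <= M.
Proof.
move=> tab /cvgrPdist_lt ct fM.
have ab : a <= b by move: tab; rewrite in_itv/= => /andP[]; exact: le_trans.
apply/ler_addgt0Pr => e e0; have [d /= d0 Hd] := ct e e0.
have [n tn] := dense_seqP tab d0.
have := Hd _ tn (dense_seq_in n ab) => lt.
rewrite -(subrK (f (dense_seq a b n)) (f t)) (le_trans (ler_normD _ _))//.
by rewrite addrC lerD// ltW.
Qed.

End dense_points.

Section kernel.
Context {R : realType}.
Variables (r : R) (k : R -> R -> R) (Psi g : R -> R).
Hypothesis r_gt0 : 0 < r.
Hypothesis k_ge0 :
  forall t s, t \in `[- r, 1] -> s \in `[0, 1] -> 0 <= k t s.
Hypothesis k_meas : leb2_measurable (`[- r, 1] `*` `[0, 1]) (fun z => k z.1 z.2).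
Hypothesis k_eq0 : forall t, t \in `[- r, 0] ->
  {ae leb R, forall s, s \in `[0, 1] -> k t s = 0}.
Hypothesis dk_jump : {ae leb R, forall s, s \in `[0, 1] ->
  C1_but_jump (- r) 1 s (fun t => k t s)}.
Hypothesis dk_le : forall t, t \in `[0, 1] ->
  {ae leb R, forall s, s \in `[0, 1] ->
     `|derive_itv (- r) 1 (fun t' => k t' s) t| <= Psi s}.
Hypothesis g_meas : leb_measurable `[0, 1] g.
Hypothesis g_ge0 : {ae leb R, forall t, t \in `[0, 1] -> 0 <= g t}.
Hypothesis Psi_L1 : L1 0 1 Psi.
Hypothesis gPsi_L1 : L1 0 1 (fun s => g s * Psi s).

Definition dkernel t s := derive_itv (- r) 1 (fun t' => k t' s) t.
Let kd := dkernel.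

Notation J f := (\int[leb R]_(s in `[0, 1]) f s).

Let r1' : - r < 1. Proof. by have := r_gt0; lra. Qed.
Let r0' : - r <= 0. Proof. by have := r_gt0; lra. Qed.

Let sub0 t : t \in `[- r, 0] -> t \in `[- r, 1].
Proof. by rewrite !in_itv/=; lra. Qed.

Let sub1 t : t \in `[0, 1] -> t \in `[- r, 1].
Proof. by rewrite !in_itv/=; have := r_gt0; lra. Qed.

Let mI : measurable (`[0, 1]%classic : set (lebesgueTypeR R)).
Proof. by apply: measurable_leb; exact: measurable_itv. Qed.

(** One condition on [s] for all [t] at once. The bound by [Psi] leaves out [t = s], where [kd] need
    not be a derivative. *)
Definition good s := [/\ C1_but_jump (- r) 1 s (fun t => k t s),
  forall t, t \in `[0, 1] -> t != s -> `|kd t s| <= Psi s,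
  forall t, t \in `[- r, 0] -> k t s = 0 & 0 <= g s].

(** The null sets belonging to the members of a dense sequence of [t] have a null union. Outside it
    the bound and the vanishing extend to the other [t] by continuity of [kd] away from [s] and of
    [k] everywhere. *)
Lemma ae_good : {ae leb R, forall s, s \in `[0, 1] -> good s}.
Proof.
have A1 := leb_ae_all (fun n => dk_le (dense_seq_in n ler01)).
have A2 := leb_ae_all (fun n => k_eq0 (dense_seq_in n r0')).
apply: leb_ae2 (leb_ae2 (fun s => @conj _ _) A1 A2)
  (leb_ae2 (fun s => @conj _ _) dk_jump g_ge0) => s [H1 H2] [H3 H4] s01.
have c := H3 s01; have [c1 c2 c3 _ _] := c; split => //; last exact: H4.
- move=> t t01 ts; apply: (@le_dense_seq R 0 1 t (fun t => kd t s)) => //.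
    by apply: cvg_withinW (c3 t (sub1 t01) ts) => u; exact: sub1.
  by move=> n; exact: H1.
- move=> t tr; apply/eqP; rewrite -normr_le0.
  apply: (@le_dense_seq R (- r) 0 t (fun t => k t s)) => //.
    have /subspace_continuousP/(_ t (sub0 tr)) := c1.
    by apply: cvg_withinW => u; exact: sub0.
  by move=> n; rewrite H2// normr0.
Qed.

(** * Estimates on the kernel for a fixed good [s] *)

Section good_point.
Variable s : R.
Hypotheses (s01 : s \in `[0, 1]) (gs : good s).

(** On [[-r, 0]], even at 0, the derivative relative to [[-r, 1]] is the one relative to [[-r, 0]],
    where [k] vanishes. *)
Lemma dkernel_le_left t : t \in `[- r, 0] -> t != s -> kd t s = 0.
Proof.
move=> tr ts; have [[c1 c2 _ _ _] _ k0 _] := gs.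
have r0 : - r < 0 by rewrite oppr_lt0.
have sub u : u \in `[- r, 0] -> 0 + u \in `[- r, 1] by rewrite add0r; exact: sub0.
have [_] := Defs.derive_shift r0 sub tr (ltac:(rewrite add0r; exact: c2 (sub0 tr) ts)).
rewrite add0r /kd /dkernel => <-; rewrite -[RHS](C1_derive0 tr); apply: derive_itv_eq => // u ur.
by rewrite add0r k0.
Qed.

Lemma good_Psi_ge0 : 0 <= Psi s.
Proof.
have [_ Psi_le _ _] := gs; have [s0|s0] := eqVneq s 0.
  by apply: le_trans (Psi_le 1 _ _); rewrite ?s0 ?in_itv/= ?ler01 ?lexx// oner_neq0.
by apply: le_trans (Psi_le 0 _ _); rewrite ?in_itv/= ?ler01 ?lexx// eq_sym.
Qed.

Lemma dkernel_le t : t \in `[- r, 1] -> t != s -> `|kd t s| <= Psi s.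
Proof.
move=> tr ts; have [_ Psi_le _ _] := gs; have [t0|t0] := leP t 0.
  rewrite dkernel_le_left ?normr0 ?good_Psi_ge0//.
  by move: tr; rewrite !in_itv/= t0 => /andP[->].
by apply: Psi_le => //; move: tr; rewrite !in_itv/= (ltW t0) => /andP[_ ->].
Qed.

(** The mean value theorem applies on either side of [s], and continuity of [k] at [s] lets the two
    estimates be added. *)
Lemma kernel_lip t u : t \in `[- r, 1] -> u \in `[- r, 1] ->
  `|k u s - k t s| <= Psi s * `|u - t|.
Proof.
wlog tu : t u / t <= u.
  move=> H; have [tu|ut] := leP t u; first exact: H.
  by move=> tr ur; rewrite distrC [X in _ * X]distrC; apply: H => //; exact: ltW.
have [[c1 c2 _ _ _] _ _ _] := gs.
have lip x y : - r <= x -> x <= y -> y <= 1 -> (s <= x) || (y <= s) ->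
    `|k y s - k x s| <= Psi s * (y - x).
  move=> rx xy y1 sxy.
  have ne z : x < z -> z < y -> z != s.
    by move=> xz zy; apply/eqP => zs; move: sxy; rewrite -zs; lra.
  have inr z : x < z -> z < y -> z \in `[- r, 1] by rewrite in_itv/=; lra.
  apply: (lipschitz_itv (f := fun t => k t s) rx xy y1 c1) => z xz zy.
    by apply: c2; [exact: inr|exact: ne].
  by apply: dkernel_le; [exact: inr|exact: ne].
rewrite !in_itv/= => /andP[rt t1] /andP[ru u1].
rewrite (ger0_norm (x := u - t)) ?subr_ge0//.
have [/andP[ts su]|] := boolP ((t <= s) && (s <= u)); last first.
  by rewrite negb_and -!ltNge => /orP H; apply: lip => //; apply/orP;
     case: H => /ltW; [left|right].
have L1 : `|k s s - k t s| <= Psi s * (s - t).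
  by apply: lip => //; rewrite ?lexx ?orbT// (le_trans su).
have L2 : `|k u s - k s s| <= Psi s * (u - s).
  by apply: lip => //; rewrite ?lexx// (le_trans rt).
rewrite -(subrKA (k s s)) (le_trans (ler_normD _ _))//.
by rewrite (le_trans (lerD L2 L1))// -mulrDr addrA subrK.
Qed.

(** [k] vanishes at [t = 0], and a positive [t] is at distance at most 1 from it, so the Lipschitz
    constant itself is a bound. *)
Lemma kernel_le t : t \in `[- r, 1] -> `|k t s| <= Psi s.
Proof.
move=> tr; have [_ _ k0 _] := gs.
have zr : 0 \in `[- r, 0] by rewrite in_itv/= lexx oppr_le0 ltW.
have [t0|t0] := leP t 0.
  rewrite k0 ?normr0 ?good_Psi_ge0//.
  by move: tr; rewrite !in_itv/= t0 => /andP[->].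
have := kernel_lip (sub0 zr) tr; rewrite (k0 0)// !subr0 => /le_trans; apply.
rewrite ler_piMr ?good_Psi_ge0// gtr0_norm//.
by move: tr; rewrite in_itv/= => /andP[].
Qed.

Lemma kernel_cvg t (u : nat -> R) : t \in `[- r, 1] ->
  (forall n, u n \in `[- r, 1]) -> u n @[n --> \oo] --> t ->
  k (u n) s @[n --> \oo] --> k t s.
Proof.
move=> tr ur ut; have [[c1 _ _ _ _] _ _ _] := gs.
have /subspace_continuousP/(_ t tr) c := c1.
exact: (within_seq_cvg (f := fun t => k t s) c).
Qed.

Lemma dkernel_cvg t (u : nat -> R) : t \in `[- r, 1] -> t != s ->
  (forall n, u n \in `[- r, 1]) -> u n @[n --> \oo] --> t ->
  kd (u n) s @[n --> \oo] --> kd t s.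
Proof.
move=> tr ts ur ut; have [[_ _ c3 _ _] _ _ _] := gs.
exact: (within_seq_cvg (f := fun t => kd t s) (c3 t tr ts)).
Qed.

Lemma diffquot_kernel_cvg t (u : nat -> R) : t \in `[- r, 1] -> t != s ->
  (forall n, u n \in `[- r, 1] /\ u n != t) -> u n @[n --> \oo] --> t ->
  diffquot (fun t => k t s) t (u n) @[n --> \oo] --> kd t s.
Proof.
move=> tr ts ur ut; have [[_ c2 _ _ _] _ _ _] := gs.
have c : diffquot (fun t => k t s) t @ within `[- r, 1] t^' --> kd t s.
  by rewrite /kd /dkernel /derive_itv r1'; exact: c2.
rewrite within_dnbhsE in c.
by apply: (within_seq_cvg c) ut => n; have [? /eqP] := ur n.
Qed.

Lemma diffquot_kernel_le t u : t \in `[- r, 1] -> u \in `[- r, 1] ->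
  `|diffquot (fun t => k t s) t u| <= Psi s.
Proof.
move=> tr ur; rewrite /diffquot; have [->|ut] := eqVneq u t.
  by rewrite subrr mul0r normr0 good_Psi_ge0.
rewrite normrM normfV ler_pdivrMr ?normr_gt0 ?subr_eq0//; exact: kernel_lip.
Qed.

End good_point.

Lemma exists_seq_itv t (P : R -> Prop) : t \in `[- r, 1] ->
    (forall x y, - r <= x -> x < y -> y <= 1 -> exists2 u, u \in `[x, y] & P u) ->
  exists u : nat -> R, [/\ forall n, u n \in `[- r, 1], forall n, P (u n) &
    u n @[n --> \oo] --> t].
Proof.
rewrite in_itv/= => /andP[rt t1] HP.
have H n : exists u, [/\ u \in `[- r, 1], P u & `|t - u| < n.+1%:R^-1].
  have n0 : 0 < n.+1%:R^-1 / 2 :> R by rewrite divr_gt0// invr_gt0.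
  have n1 : n.+1%:R^-1 / 2 < n.+1%:R^-1 :> R.
    by rewrite ltr_pdivrMr// ltr_pMr ?ltr1n// invr_gt0.
  move: n0 n1; set e := _ / 2; set e' := _^-1 => e0 ee'.
  have [|||u] := HP (Num.max (- r) (t - e)) (Num.min 1 (t + e)).
  - by rewrite le_max lexx.
  - rewrite gt_max !lt_min r1'; apply/andP; split; apply/andP; split=> //; lra.
  - by rewrite ge_min lexx.
  rewrite in_itv/= ge_max le_min => /andP[/andP[ru tu] /andP[u1 ut]] Pu.
  by exists u; split => //; [rewrite in_itv/= ru|rewrite ltr_norml; lra].
exists (fun n => sval (cid (H n))); split.
- by move=> n; case: cid => u [].
- by move=> n; case: cid => u [].
apply/cvgrPdist_lt => d d0; near=> n; case: cid => /= u [_ _ tu].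
by rewrite (lt_trans tu)//; near: n; exact: (near_infty_natSinv_lt (PosNum d0)).
Unshelve. all: by end_near. Qed.

(** Measurability in the plane gives this for almost every [t]. Any other [t] is a limit of such
    points, along which [k] converges for almost every [s]. *)
Lemma kernel_measurable t : t \in `[- r, 1] -> leb_measurable `[0, 1] (k t).
Proof.
move=> tr.
have [|u [ur mu ut]] :=
    @exists_seq_itv t (fun u => leb_measurable `[0, 1] (k u)) tr.
  move=> x y rx xy y1.
  have [v vxy mv] := ae_exists_itv xy (ae_leb_measurable_section k_meas).
  exists v => //; apply: mv; move: vxy; rewrite !in_itv/=; lra.
apply: (leb_measurable_ae_cvg (h := fun n => k (u n)) mu).
by apply: leb_ae ae_good => s gs s01; exact: kernel_cvg (gs s01) _ _ tr ur ut.
Qed.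

Lemma exists_seq_neq t : t \in `[- r, 1] -> exists u : nat -> R,
  (forall n, u n \in `[- r, 1] /\ u n != t) /\ u n @[n --> \oo] --> t.
Proof.
move=> tr; have [|u [ur un ut]] := @exists_seq_itv t (fun u => u != t) tr.
  move=> x y rx xy y1; have [xt|xt] := eqVneq x t.
    by exists y; rewrite ?in_itv/= ?lexx ?(ltW xy)// -xt gt_eqF.
  by exists x => //; rewrite in_itv/= lexx ltW.
by exists u; split => // n; split.
Qed.

Lemma diffquot_measurable t u : t \in `[- r, 1] -> u \in `[- r, 1] ->
  leb_measurable `[0, 1] (fun s => diffquot (fun t => k t s) t u).
Proof.
move=> tr ur; apply: measurable_funM; last exact: measurable_cst.
by apply: measurable_funB; exact: kernel_measurable.
Qed.

Lemma dkernel_measurable t : t \in `[- r, 1] -> leb_measurable `[0, 1] (kd t).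
Proof.
move=> tr; have [u [ur ut]] := exists_seq_neq tr.
apply: (leb_measurable_ae_cvg
  (h := fun n s => diffquot (fun t => k t s) t (u n)) (fun n => diffquot_measurable tr (ur n).1)).
apply: leb_ae2 ae_good (ae_neq t) => s gs st s01.
by apply: diffquot_kernel_cvg (gs s01) _ _ tr _ ur ut; rewrite eq_sym.
Qed.

Let wgt s := g s * Psi s.

Lemma weight_integrable (C : R) :
  (leb R).-integrable `[0, 1] (EFin \o (fun s => C * wgt s)).
Proof. exact: (integrableZl mI C gPsi_L1). Qed.

(** The integrals below all have this form: a kernel factor bounded by [C * Psi], the weight [g],
    and a bounded function. The right-hand side is their common dominating function. *)
Lemma weighted_le (w h : R -> R) (C M : R) :
    {ae leb R, forall s, s \in `[0, 1] -> `|w s| <= C * Psi s} ->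
    {ae leb R, forall s, s \in `[0, 1] -> `|h s| <= M} ->
  {ae leb R, forall s, s \in `[0, 1] -> `|w s * g s * h s| <= (C * M) * wgt s}.
Proof.
move=> wC hM; apply: leb_ae2 ae_good (leb_ae2 (fun s => @conj _ _) wC hM).
move=> s gs [H1 H2] s01; have [_ _ _ g0] := gs s01.
have -> : C * M * wgt s = C * Psi s * g s * M by rewrite /wgt; ring.
rewrite !normrM (ger0_norm g0); apply: ler_pM => //; last exact: H2.
  by rewrite mulr_ge0.
by apply: ler_wpM2r => //; exact: H1.
Qed.

Lemma weighted_measurable (w h : R -> R) : leb_measurable `[0, 1] w ->
  leb_measurable `[0, 1] h -> leb_measurable `[0, 1] (fun s => w s * g s * h s).
Proof. by move=> mw mh; apply: measurable_funM mh; exact: measurable_funM g_meas. Qed.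

Lemma weighted_integrable (w h : R -> R) (C M : R) :
    leb_measurable `[0, 1] w -> leb_measurable `[0, 1] h ->
    {ae leb R, forall s, s \in `[0, 1] -> `|w s| <= C * Psi s} ->
    {ae leb R, forall s, s \in `[0, 1] -> `|h s| <= M} ->
  (leb R).-integrable `[0, 1] (EFin \o (fun s => w s * g s * h s)).
Proof.
move=> mw mh wC hM; apply: (leb_integrable_le mI) (weighted_le wC hM).
  exact: weighted_measurable.
exact: weight_integrable.
Qed.

Lemma weighted_norm_le (w h : R -> R) (C M : R) :
    leb_measurable `[0, 1] w -> leb_measurable `[0, 1] h ->
    {ae leb R, forall s, s \in `[0, 1] -> `|w s| <= C * Psi s} ->
    {ae leb R, forall s, s \in `[0, 1] -> `|h s| <= M} ->
  `|J (fun s => w s * g s * h s)| <= C * M * J wgt.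
Proof.
move=> mw mh wC hM; rewrite -(RintegralZl _ mI gPsi_L1).
apply: (leb_integral_norm_le mI) (weighted_le wC hM).
  exact: weighted_measurable.
exact: weight_integrable.
Qed.

Lemma weighted_cvg (w h : nat -> R -> R) (v f : R -> R) (C M : R) :
    (forall n, leb_measurable `[0, 1] (w n)) ->
    (forall n, leb_measurable `[0, 1] (h n)) ->
    {ae leb R, forall s, s \in `[0, 1] -> w n s @[n --> \oo] --> v s} ->
    {ae leb R, forall s, s \in `[0, 1] -> h n s @[n --> \oo] --> f s} ->
    (forall n, {ae leb R, forall s, s \in `[0, 1] -> `|w n s| <= C * Psi s}) ->
    (forall n, {ae leb R, forall s, s \in `[0, 1] -> `|h n s| <= M}) ->
  J (fun s => w n s * g s * h n s) @[n --> \oo] -->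
    J (fun s => v s * g s * f s).
Proof.
move=> mw mh wv hf wC hM.
apply: (@leb_integral_cvg _ _ mI _ _ (fun s => (C * M) * wgt s)).
- by move=> n; exact: weighted_measurable.
- exact: weight_integrable.
- apply: leb_ae2 wv hf => s wv hf s01.
  by apply: cvgM; [apply: cvgMr_tmp; exact: wv|exact: hf].
- exact: leb_ae_all (fun n => weighted_le (wC n) (hM n)).
Qed.

Definition int_op (h : R -> R) t := J (fun s => k t s * g s * h s).

Let dint_op (h : R -> R) t := J (fun s => kd t s * g s * h s).

(** The factor 1 makes the integrand an instance of the form [w s * g s * h s]. *)
Definition kernel_modulus t u := J (fun s => `|kd t s - kd u s| * g s * 1).

Lemma ae_kernel_le t : t \in `[- r, 1] ->
  {ae leb R, forall s, s \in `[0, 1] -> `|k t s| <= 1 * Psi s}.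
Proof. by move=> tr; apply: leb_ae ae_good => s gs s01; rewrite mul1r; exact: kernel_le (gs s01) _ tr. Qed.

Lemma ae_dkernel_le t : t \in `[- r, 1] ->
  {ae leb R, forall s, s \in `[0, 1] -> `|kd t s| <= 1 * Psi s}.
Proof.
move=> tr; apply: leb_ae2 ae_good (ae_neq t) => s gs st s01.
by rewrite mul1r; apply: dkernel_le (gs s01) _ tr _; rewrite eq_sym.
Qed.

Lemma ae_dkernel_cvg t (u : nat -> R) : t \in `[- r, 1] ->
    (forall n, u n \in `[- r, 1]) -> u n @[n --> \oo] --> t ->
  {ae leb R, forall s, s \in `[0, 1] -> kd (u n) s @[n --> \oo] --> kd t s}.
Proof.
move=> tr ur ut; apply: leb_ae2 ae_good (ae_neq t) => s gs st s01.
by apply: dkernel_cvg (gs s01) _ _ tr _ ur ut; rewrite eq_sym.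
Qed.

(** Almost every [s] differs from the fixed [t], and for such [s] the derivative is continuous at
    [t]. Dominated convergence applies with [2 * Psi]. *)
Lemma kernel_modulus_cvg t : t \in `[- r, 1] ->
  kernel_modulus t u @[u --> within `[- r, 1] (nbhs t)] --> 0.
Proof.
move=> tr; apply: cvg_within_seq => x xr xt.
have -> : 0 = J (fun s => 0 * g s * 1).
  have -> : (fun s => 0 * g s * 1) = cst 0 by apply/funext => s; rewrite !mul0r.
  by rewrite (Rintegral_cst _ mI) mul0r.
apply: (@weighted_cvg (fun n s => `|kd t s - kd (x n) s|) (fun _ => cst 1) _ _ 2 1).
- move=> n; apply: leb_measurable_norm; apply: measurable_funB.
    exact: dkernel_measurable.
  exact: dkernel_measurable (xr n).
- by move=> n; exact: measurable_cst.
- apply: leb_ae (ae_dkernel_cvg tr xr xt) => s H s01.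
  rewrite -[X in _ --> X](normr0 R) -(subrr (kd t s)).
  by apply: cvg_norm; apply: cvgB; [exact: cvg_cst|exact: H].
- by apply: leb_ae_true => s _; exact: cvg_cst.
- move=> n; apply: leb_ae2 (ae_dkernel_le tr) (ae_dkernel_le (xr n)) => s H1 H2 s01.
  rewrite normr_id (le_trans (ler_normB _ _))//.
  by rewrite (le_trans (lerD (H1 s01) (H2 s01)))// -mulrDl.
- by move=> n; apply: leb_ae_true => s _; rewrite normr1.
Qed.

(** * Differentiation under the integral sign *)

Section operator.
Variables (h : R -> R) (M : R).
Hypothesis mh : leb_measurable `[0, 1] h.
Hypothesis h_le : {ae leb R, forall s, s \in `[0, 1] -> `|h s| <= M}.

(** The Lipschitz bound dominates the difference quotients of the kernel by [Psi] for all
    increments, also across the jump, and they converge for every good [s] other than [t]. *)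
Lemma int_op_diffquot_cvg t : t \in `[- r, 1] ->
  diffquot (int_op h) t u @[u --> within `[- r, 1] t^'] --> dint_op h t.
Proof.
move=> tr; rewrite within_dnbhsE; apply: cvg_within_seq => x Dx xt.
have xr n : x n \in `[- r, 1] by case: (Dx n).
have xn n : x n != t by apply/eqP; case: (Dx n).
have int u : u \in `[- r, 1] ->
    (leb R).-integrable `[0, 1] (EFin \o (fun s => k u s * g s * h s)).
  by move=> ur; apply: weighted_integrable (kernel_measurable ur) mh (ae_kernel_le ur) h_le.
have E n : diffquot (int_op h) t (x n) =
    J (fun s => diffquot (fun t => k t s) t (x n) * g s * h s).
  rewrite /diffquot /int_op -(RintegralB mI (int _ (xr n)) (int _ tr)).
  rewrite mulrC -(RintegralZl _ mI); last first.
    by have := integrableB mI (int _ (xr n)) (int _ tr).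
  by apply: eq_Rintegral => s _; rewrite -!mulrBl; ring.
under eq_fun do rewrite E.
apply: (@weighted_cvg (fun n s => diffquot (fun t => k t s) t (x n)) (fun=> h)
  (kd t) h 1 M) => //.
- by move=> n; exact: diffquot_measurable.
- apply: leb_ae2 ae_good (ae_neq t) => s gs st s01.
  apply: diffquot_kernel_cvg (gs s01) _ _ tr _ (fun n => conj (xr n) (xn n)) xt.
  by rewrite eq_sym.
- by apply: leb_ae_true => s _; exact: cvg_cst.
- move=> n; apply: leb_ae ae_good => s gs s01.
  by rewrite mul1r; exact: diffquot_kernel_le (gs s01) _ _ tr (xr n).
Qed.

Lemma derive_int_op t : t \in `[- r, 1] ->
  derive_itv (- r) 1 (int_op h) t = dint_op h t.
Proof.
move=> tr; rewrite /derive_itv r1'.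
by have ? := within_dnbhs_proper r1' tr; exact/cvg_lim/int_op_diffquot_cvg.
Qed.

Lemma dint_op_dist t u : t \in `[- r, 1] -> u \in `[- r, 1] ->
  `|dint_op h t - dint_op h u| <= M * kernel_modulus t u.
Proof.
move=> tr ur.
have mt := dkernel_measurable tr; have mu := dkernel_measurable ur.
have it := weighted_integrable mt mh (ae_dkernel_le tr) h_le.
have iu := weighted_integrable mu mh (ae_dkernel_le ur) h_le.
have md : leb_measurable `[0, 1] (fun s => `|kd t s - kd u s|).
  by apply: leb_measurable_norm; exact: measurable_funB mt mu.
have im : (leb R).-integrable `[0, 1]
    (EFin \o (fun s => `|kd t s - kd u s| * g s * 1)).
  apply: (@weighted_integrable (fun s => `|kd t s - kd u s|) (cst 1) 2 1) => //.
  - exact: measurable_cst.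
  - apply: leb_ae2 (ae_dkernel_le tr) (ae_dkernel_le ur) => s H1 H2 s01.
    rewrite normr_id (le_trans (ler_normB _ _))//.
    by rewrite (le_trans (lerD (H1 s01) (H2 s01)))// -mulrDl.
  - by apply: leb_ae_true => s _; rewrite normr1.
rewrite /dint_op -(RintegralB mI it iu) /kernel_modulus -(RintegralZl _ mI im).
apply: (leb_integral_norm_le mI).
- apply: measurable_funB; exact: weighted_measurable.
- exact: (integrableZl mI M im).
- apply: leb_ae2 ae_good h_le => s gs hM s01; have [_ _ _ g0] := gs s01.
  rewrite -!mulrBl !normrM (ger0_norm g0) mulr1 mulrC ler_wpM2r//.
    by rewrite mulr_ge0.
  exact: hM.
Qed.

Lemma int_op_C1 : is_C1 (- r) 1 (int_op h).
Proof.
split=> [t tr|]; first by apply/cvg_ex; eexists; exact: int_op_diffquot_cvg.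
apply/subspace_continuousP => t tr.
suff : derive_itv (- r) 1 (int_op h) u @[u --> within `[- r, 1] (nbhs t)] -->
    dint_op h t by rewrite -(derive_int_op tr).
have := kernel_modulus_cvg tr; move=> /(@cvgMl_tmp _ _ _ _ _ M).
rewrite mulr0 => /cvgrPdist_le c; apply/cvgrPdist_le => e e0.
have [d /= d0 Hd] := c e e0; exists d => //= u tu ur.
rewrite derive_int_op//; have := Hd u tu ur; rewrite sub0r normrN => H.
exact: le_trans (dint_op_dist tr ur) (le_trans (ler_norm _) H).
Qed.

Lemma int_opE t : t \in `[- r, 1] ->
  (\int[leb R]_(s in `[0%R, 1%R]) (k t s * g s * h s)%:E)%E = (int_op h t)%:E.
Proof.
move=> tr; rewrite /int_op /Rintegral fineK//; apply: integrable_fin_num => //.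
exact: weighted_integrable (kernel_measurable tr) mh (ae_kernel_le tr) h_le.
Qed.

Definition int_opC1 : C1 (- r) 1 := toC1 (- r) 1 (int_op h).

Lemma int_opC1E t : t \in `[- r, 1] -> int_opC1 t = int_op h t.
Proof. exact: toC1E int_op_C1. Qed.

Lemma derive_int_opC1 t : t \in `[- r, 1] ->
  derive_itv (- r) 1 int_opC1 t = dint_op h t.
Proof.
by move=> tr; rewrite derive_toC1 ?derive_int_op//; exact: int_op_C1.
Qed.

Lemma weight_ge0 : 0 <= J wgt.
Proof.
rewrite -[leLHS](mul0r (J wgt)) -(RintegralZl _ mI gPsi_L1).
apply: (ae_le_leb_integral mI (weight_integrable 0) gPsi_L1).
apply: leb_ae ae_good => s gs s01; rewrite mul0r mulr_ge0 ?(good_Psi_ge0 (gs s01))//.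
by case: (gs s01).
Qed.

Lemma int_opC1_norm_le : 0 <= M -> `|int_opC1| <= M * J wgt.
Proof.
move=> M0; apply: C1_norm_le => [|t tr|t tr]; first by rewrite mulr_ge0 ?weight_ge0.
  rewrite int_opC1E//.
  have := weighted_norm_le (kernel_measurable tr) mh (ae_kernel_le tr) h_le.
  by rewrite mul1r.
rewrite derive_int_opC1//.
have := weighted_norm_le (dkernel_measurable tr) mh (ae_dkernel_le tr) h_le.
by rewrite mul1r.
Qed.

Lemma int_opC1_equicontinuous t u : t \in `[- r, 1] -> u \in `[- r, 1] ->
  `|derive_itv (- r) 1 int_opC1 t - derive_itv (- r) 1 int_opC1 u| <=
    M * kernel_modulus t u.
Proof. by move=> tr ur; rewrite !derive_int_opC1//; exact: dint_op_dist. Qed.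

Lemma int_opC1_K0 : (forall s, s \in `[0, 1] -> 0 <= h s) -> K0 int_opC1.
Proof.
move=> h0; split=> t tr.
  rewrite int_opC1E// -[leLHS](mul0r (J wgt)) -(RintegralZl _ mI gPsi_L1).
  apply: (ae_le_leb_integral mI (weight_integrable 0)).
    exact: weighted_integrable (kernel_measurable tr) mh (ae_kernel_le tr) h_le.
  apply: leb_ae ae_good => s gs s01; have [_ _ _ g0] := gs s01.
  by rewrite mul0r !mulr_ge0 ?k_ge0 ?h0.
have z (w : R -> R) : leb_measurable `[0, 1] w ->
    {ae leb R, forall s, s \in `[0, 1] -> w s = 0} ->
    J (fun s => w s * g s * h s) = 0.
  move=> mw w0; rewrite -[RHS](mul0r (fine (leb R `[0, 1]))) -(Rintegral_cst _ mI).
  apply: (ae_eq_leb_integral mI); first exact: weighted_measurable.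
  by apply: leb_ae w0 => s w0 s01; rewrite w0// !mul0r.
have tr' := sub0 tr; rewrite int_opC1E// derive_int_opC1//; split; apply: z.
- exact: kernel_measurable.
- exact: k_eq0.
- exact: dkernel_measurable.
- apply: leb_ae2 ae_good (ae_neq t) => s gs st s01.
  by apply: dkernel_le_left (gs s01) _ tr _; rewrite eq_sym.
Qed.

End operator.

Lemma int_op_le (h f : R -> R) (M L : R) t : t \in `[- r, 1] ->
    leb_measurable `[0, 1] h -> leb_measurable `[0, 1] f ->
    {ae leb R, forall s, s \in `[0, 1] -> `|h s| <= M} ->
    {ae leb R, forall s, s \in `[0, 1] -> `|f s| <= L} ->
    (forall s, s \in `[0, 1] -> h s <= f s) ->
  int_op h t <= int_op f t.
Proof.
move=> tr mh mf hM fL hf; have mk := kernel_measurable tr.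
apply: (ae_le_leb_integral mI).
- exact: weighted_integrable mk mh (ae_kernel_le tr) hM.
- exact: weighted_integrable mk mf (ae_kernel_le tr) fL.
apply: leb_ae ae_good => s gs s01; have [_ _ _ g0] := gs s01.
by rewrite ler_wpM2l ?hf// mulr_ge0 ?k_ge0.
Qed.

(** The bound does not involve [w], which will be [k t] or [kd t]. It thus controls values and
    derivatives uniformly in [t], as convergence in the C^1 norm requires. *)
Lemma weighted_dist (w h f : R -> R) (M : R) :
    leb_measurable `[0, 1] w ->
    leb_measurable `[0, 1] h -> leb_measurable `[0, 1] f ->
    {ae leb R, forall s, s \in `[0, 1] -> `|w s| <= 1 * Psi s} ->
    {ae leb R, forall s, s \in `[0, 1] -> `|h s| <= M} ->
    {ae leb R, forall s, s \in `[0, 1] -> `|f s| <= M} ->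
  `|J (fun s => w s * g s * h s) - J (fun s => w s * g s * f s)| <=
    J (fun s => Psi s * g s * `|h s - f s|).
Proof.
move=> mw mh mf wP hM fM.
have mPsi : leb_measurable `[0, 1] Psi.
  by apply/leb_measurableE; case/integrableP: Psi_L1.
have mhf : leb_measurable `[0, 1] (fun s => `|h s - f s|).
  by apply: leb_measurable_norm; exact: measurable_funB.
rewrite -(RintegralB mI (weighted_integrable mw mh wP hM)
  (weighted_integrable mw mf wP fM)).
apply: (leb_integral_norm_le mI).
- by apply: measurable_funB; exact: weighted_measurable.
- apply: (@weighted_integrable Psi (fun s => `|h s - f s|) 1 (M + M)) => //.
    by apply: leb_ae ae_good => s gs s01; rewrite mul1r ger0_norm// (good_Psi_ge0 (gs s01)).
  apply: leb_ae2 hM fM => s hM fM s01; rewrite normr_id.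
  by rewrite (le_trans (ler_normB _ _))// lerD ?hM ?fM.
apply: leb_ae2 ae_good wP => s gs wP s01; have [_ _ _ g0] := gs s01.
rewrite -mulrBr !normrM (ger0_norm g0) ler_wpM2r// ler_wpM2r//.
by have := wP s01; rewrite mul1r.
Qed.

Lemma int_opC1_cvg (h : nat -> R -> R) (f : R -> R) (M : R) :
    (forall n, leb_measurable `[0, 1] (h n)) -> leb_measurable `[0, 1] f ->
    (forall n, {ae leb R, forall s, s \in `[0, 1] -> `|h n s| <= M}) ->
    {ae leb R, forall s, s \in `[0, 1] -> `|f s| <= M} ->
    {ae leb R, forall s, s \in `[0, 1] -> h n s @[n --> \oo] --> f s} ->
  int_opC1 (h n) @[n --> \oo] --> int_opC1 f.
Proof.
move=> mh mf hM fM hf.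
have mPsi : leb_measurable `[0, 1] Psi.
  by apply/leb_measurableE; case/integrableP: Psi_L1.
have z : J (fun s => Psi s * g s * 0) = 0.
  by under eq_Rintegral do rewrite mulr0; rewrite (Rintegral_cst _ mI) mul0r.
have c : J (fun s => Psi s * g s * `|h n s - f s|) @[n --> \oo] --> 0.
  rewrite -[X in _ --> X]z.
  apply: (@weighted_cvg (fun=> Psi) (fun n s => `|h n s - f s|) _ _ 1 (M + M)) => //.
  - by move=> n; apply: leb_measurable_norm; exact: measurable_funB (mh n) mf.
  - by apply: leb_ae_true => s _; exact: cvg_cst.
  - apply: leb_ae hf => s hf s01; rewrite -[X in _ --> X](normr0 R) -(subrr (f s)).
    by apply: cvg_norm; apply: cvgB; [exact: hf|exact: cvg_cst].
  - move=> n; apply: leb_ae ae_good => s gs s01.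
    by rewrite mul1r ger0_norm// (good_Psi_ge0 (gs s01)).
  - move=> n; apply: leb_ae2 (hM n) fM => s hM' fM' s01; rewrite normr_id.
    by rewrite (le_trans (ler_normB _ _))// lerD ?hM' ?fM'.
have dist n : `|int_opC1 f - int_opC1 (h n)| <=
    J (fun s => Psi s * g s * `|h n s - f s|).
  rewrite distrC; apply: C1_norm_le => [|t tr|t tr].
  - have t0 : (0 : R) \in `[- r, 1] by rewrite in_itv/= ler01 r0'.
    exact: le_trans (normr_ge0 _) (weighted_dist (kernel_measurable t0) (mh n) mf
      (ae_kernel_le t0) (hM n) fM).
  - rewrite C1_fctB (int_opC1E (mh n) (hM n) tr) (int_opC1E mf fM tr).
    exact: weighted_dist (kernel_measurable tr) (mh n) mf (ae_kernel_le tr) (hM n) fM.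
  - rewrite C1_deriveB// (derive_int_opC1 (mh n) (hM n) tr).
    rewrite (derive_int_opC1 mf fM tr).
    exact: weighted_dist (dkernel_measurable tr) (mh n) mf (ae_dkernel_le tr) (hM n) fM.
apply/cvgrPdist_le => e e0; have /cvgrPdist_le/(_ e e0) := c.
apply: filterS => n; rewrite sub0r normrN => H.
exact: le_trans (dist n) (le_trans (ler_norm _) H).
Qed.

End kernel.

(** * The superposition operator *)

Section superposition.
Context {R : realType} (r : R) (F : R -> C1 (- r) 0 -> R).
Hypothesis r_gt0 : 0 < r.
Hypothesis F_ge0 : forall t phi, t \in `[0, 1] -> 0 <= F t phi.
Hypothesis F_meas : forall phi, leb_measurable `[0, 1] (fun t => F t phi).
Hypothesis F_cont : {ae leb R, forall t, t \in `[0, 1] -> continuous (F t)}.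
Hypothesis F_bound : forall M : R, 0 < M -> exists2 phiM : R -> R,
  Linfty 0 1 phiM & forall phi : C1 (- r) 0, `|phi| <= M ->
    {ae leb R, forall t, t \in `[0, 1] -> F t phi <= phiM t}.
Implicit Types (u : C1 (- r) 1).

Definition hist_op u s := F s (hist u s).

(* The sum has one nonzero term, with [j = floor (s * n.+1)]. *)
Let step u (n : nat) s := \sum_(j < n.+2)
  \1_(`[j%:R / n.+1%:R, j.+1%:R / n.+1%:R[ : set R) s *
    F s (hist u (j%:R / n.+1%:R)).

Let stepE u n s : s \in `[0, 1] -> exists x, [/\ x \in `[0, 1],
  `|s - x| <= n.+1%:R^-1 & step u n s = F s (hist u x)].
Proof.
rewrite in_itv/= => /andP[s0 s1].
have n0 : 0 < n.+1%:R :> R by [].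
have /andP[] := truncn_itv (mulr_ge0 s0 (ltW n0)).
set j := Num.truncn _ => j1 j2.
have jn : (j < n.+2)%N.
  rewrite -(ltr_nat R) (le_lt_trans j1)// (@le_lt_trans _ _ n.+1%:R) ?ltr_nat//.
  by rewrite ler_piMl// ltW.
have j1' : j%:R / n.+1%:R <= s by rewrite ler_pdivrMr.
have j2' : s < j.+1%:R / n.+1%:R by rewrite ltr_pdivlMr.
exists (j%:R / n.+1%:R); split.
- by rewrite in_itv/= divr_ge0//= (le_trans j1').
- rewrite ger0_norm ?subr_ge0// lerBlDl -[X in _ + X]mul1r -mulrDl natr1.
  exact: ltW.
rewrite /step (bigD1 (Ordinal jn))//= big1 => [|i ij].
  by rewrite indicE mem_set ?mul1r ?addr0//= in_itv/= j1' j2'.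
rewrite indicE memNset ?mul0r//= in_itv/= => /andP[].
rewrite ler_pdivrMr// ltr_pdivlMr// => i1 i2.
have := le_lt_trans i1 j2; have := le_lt_trans j1 i2; rewrite !ltr_nat !ltnS => ji i'j.
by move/negP: ij; apply; apply/eqP/val_inj/eqP; rewrite /= eqn_leq i'j.
Qed.

(** Serves twice: with [v] constant for measurability of the superposition in time, and with [x]
    constant for its continuity in the function. *)
Lemma hist_op_cvg (s : R) (v : nat -> C1 (- r) 1) (x : nat -> R) u :
    s \in `[0, 1] -> continuous (F s) -> (forall n, x n \in `[0, 1]) ->
    x n @[n --> \oo] --> s -> v n @[n --> \oo] --> u ->
  F s (hist (v n) (x n)) @[n --> \oo] --> F s (hist u s).
Proof.
move=> s01 cF x01 xs vu; apply: (@cvg_comp _ _ _ _ (F s)); last exact: cF.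
have hx : hist u (x n) @[n --> \oo] --> hist u s.
  apply: (@within_seq_cvg R R^o (C1 (- r) 0) `[0, 1]%classic s (hist u)) => //.
  exact: hist_continuous.
have hv : hist (v n) (x n) - hist u (x n) @[n --> \oo] --> (0 : C1 (- r) 0).
  apply/cvgrPdist_le => e e0; have /cvgrPdist_le/(_ e e0) := vu.
  apply: filterS => n vn; rewrite sub0r normrN (le_trans (hist_dist r_gt0 _ _ (x01 n)))//.
  by rewrite distrC.
have -> : (fun n => hist (v n) (x n)) =
    (fun n => (hist (v n) (x n) - hist u (x n)) + hist u (x n)).
  by apply/funext => n; rewrite subrK.
have H := cvgD hv hx; rewrite add0r in H; exact: H.
Qed.

(** Freezing the history on short time intervals gives finite sums of measurable functions. They
    converge because the history is continuous in time and [F s] is continuous for almost every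
    [s]. *)
Lemma hist_op_measurable u : leb_measurable `[0, 1] (hist_op u).
Proof.
apply: (@leb_measurable_ae_cvg _ _ (step u)).
  move=> n; apply: measurable_sum => j; apply: measurable_funM; last exact: F_meas.
  by apply: measurable_indic; apply: measurable_leb; exact: measurable_itv.
apply: leb_ae F_cont => s cF s01.
pose x n := sval (cid (stepE u n s01)).
have xP n : [/\ x n \in `[0, 1], `|s - x n| <= n.+1%:R^-1 &
    step u n s = F s (hist u (x n))] by rewrite /x; case: cid.
have xs : x n @[n --> \oo] --> s.
  apply/cvgrPdist_lt => d d0; near=> n; have [_ sx _] := xP n.
  by rewrite (le_lt_trans sx)//; near: n; exact: (near_infty_natSinv_lt (PosNum d0)).
have -> : (fun n => step u n s) = (fun n => F s (hist u (x n))).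
  by apply/funext => n; case: (xP n).
apply: (@hist_op_cvg s (fun=> u)) => //; [exact: cF|by move=> n; case: (xP n)|].
exact: cvg_cst.
Unshelve. all: by end_near. Qed.

(** The growth bound has a null set for each history, while here the history varies with [s]. So it
    is used for the histories at a dense sequence of times, and continuity carries it to time [s]
    itself. *)
Lemma hist_op_bounded (L : R) : 0 < L -> exists2 M, 0 <= M &
  forall u, `|u| <= L ->
    {ae leb R, forall s, s \in `[0, 1] -> `|hist_op u s| <= M}.
Proof.
move=> L0; have [phi [_ [M phiM]] Fphi] := F_bound L0.
exists `|M| => // u uL.
have A n := Fphi _ (le_trans (hist_le_norm r_gt0 u (dense_seq_in n ler01)) uL).
apply: leb_ae2 (leb_ae2 (fun s => @conj _ _) (leb_ae_all A) phiM) F_cont.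
move=> s [H1 H2] cF s01.
apply: (@le_dense_seq R 0 1 s (fun t => F s (hist u t))) => // [|n].
  apply: (@cvg_comp _ _ _ _ (F s)); first exact: hist_continuous.
  exact: cF.
rewrite ger0_norm ?F_ge0// (le_trans (H1 n s01))//.
by rewrite (le_trans (ler_norm _))// (le_trans (H2 s01))// ler_norm.
Qed.

End superposition.

(** * Application to the integral equation *)

Lemma continuous_leb_measurable {R : realType} (a b : R) (f : R -> R) :
  {within `[a, b], continuous f} -> leb_measurable `[a, b] f.
Proof.
move=> cf _ Y mY; apply: measurable_leb.
have mf := subspace_continuous_measurable_fun (measurable_itv `[a, b]) cf.
exact: (mf (measurable_itv `[a, b]) Y mY).
Qed.

Unset Implicit Arguments.

Theorem theorem3p2 (R : realType) (r : R) (psi gamma : C1 (- r) 1)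
  (k : R -> R -> R) (Psi g : R -> R) (F : R -> C1 (- r) 0 -> R)
  (r_gt0 : 0 < r)
  (psi_ge0 : forall t, t \in `[- r, 1] -> 0 <= psi t)
  (psi_eq0 : forall t, t \in `[0, 1] ->
     psi t = 0 /\ derive_itv (- r) 1 psi t = 0)
  (k_ge0 : forall t s, t \in `[- r, 1] -> s \in `[0, 1] -> 0 <= k t s)
  (k_meas : leb2_measurable (`[- r, 1] `*` `[0, 1]) (fun z => k z.1 z.2))
  (k_eq0 : forall t, t \in `[- r, 0] ->
     {ae leb R, forall s, s \in `[0, 1] -> k t s = 0})
  (k_cont : forall tbar, tbar \in `[0, 1] ->
     {ae leb R, forall s, s \in `[0, 1] ->
        `|k t s - k tbar s| @[t --> within `[- r, 1] (nbhs tbar)] --> 0})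
  (dk_jump : {ae leb R, forall s, s \in `[0, 1] ->
     C1_but_jump (- r) 1 s (fun t => k t s)})
  (Psi_L1 : L1 0 1 Psi)
  (dk_le : forall t, t \in `[0, 1] ->
     {ae leb R, forall s, s \in `[0, 1] ->
        `|derive_itv (- r) 1 (fun t' => k t' s) t| <= Psi s})
  (g_meas : leb_measurable `[0, 1] g)
  (g_ge0 : {ae leb R, forall t, t \in `[0, 1] -> 0 <= g t})
  (gPsi_L1 : L1 0 1 (fun s => g s * Psi s))
  (Psig_gt0 : exists a b : R, [/\ 0 <= a, a < b, b <= 1 &
     (0 < \int[leb R]_(s in `[a, b]) (Psi s * g s)%:E)%E])
  (F_ge0 : forall t phi, t \in `[0, 1] -> 0 <= F t phi)
  (F_meas : forall phi, leb_measurable `[0, 1] (fun t => F t phi))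
  (F_cont : {ae leb R, forall t, t \in `[0, 1] -> continuous (F t)})
  (F_bound : forall M : R, 0 < M -> exists2 phiM : R -> R, Linfty 0 1 phiM &
     forall phi : C1 (- r) 0, `|phi| <= M ->
       {ae leb R, forall t, t \in `[0, 1] -> F t phi <= phiM t})
  (gamma_ge0 : forall t, t \in `[- r, 1] -> 0 <= gamma t)
  (gamma_eq0 : forall t, t \in `[- r, 0] ->
     gamma t = 0 /\ derive_itv (- r) 1 gamma t = 0)
  (rho : R) (rho_gt0 : 0 < rho)
  (delta : R -> R)
  (delta_cont : {within `[0, 1], continuous delta})
  (delta_ge0 : forall t, t \in `[0, 1] -> 0 <= delta t)
  (F_ge : forall t u, t \in `[0, 1] -> K_boundary psi rho u ->
     delta t <= F t (hist u t))
  (B : C1 (- r) 1 -> R)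
  (B_ge0 : forall u, K_closure psi rho u -> 0 <= B u)
  (B_cont : {within K_closure psi rho, continuous B})
  (B_bound : exists M : R, forall u, K_closure psi rho u -> B u <= M)
  (eta : R) (eta_ge0 : 0 <= eta)
  (B_ge : forall u, K_boundary psi rho u -> eta <= B u)
  (sup_gt0 : (0 < ereal_sup [set (gamma t * eta)%:E +
       \int[leb R]_(s in `[0%R, 1%R]) (k t s * g s * delta s)%:E
       | t in `[0%R, 1%R]])%E) :
  exists (lambda : R) (u : C1 (- r) 1),
    [/\ 0 < lambda, K_boundary psi rho u &
      forall t, t \in `[- r, 1] ->
        ((u t)%:E = (psi t)%:E + lambda%:E *
           (\int[leb R]_(s in `[0%R, 1%R]) (k t s * g s * F s (hist u s))%:E
            + (gamma t * B u)%:E))%E].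
Proof.
pose T h := int_opC1 r k g h.
pose W := \int[leb R]_(s in `[0, 1]) (g s * Psi s).
pose bnd (h : R -> R) (M : R) := {ae leb R, forall s, s \in `[0, 1] -> `|h s| <= M}.
have opE (h : R -> R) (M t : R) (mh : leb_measurable `[0, 1] h) (hM : bnd h M) :=
  int_opE r_gt0 k_meas k_eq0 dk_jump dk_le g_meas g_ge0 gPsi_L1 mh hM (t := t).
have TE (h : R -> R) (M t : R) (mh : leb_measurable `[0, 1] h) (hM : bnd h M) :=
  int_opC1E r_gt0 k_meas k_eq0 dk_jump dk_le g_meas g_ge0 gPsi_L1 mh hM (t := t).
(* Positivity of the supremum provides [t0]; evaluation there is the functional that keeps the
   auxiliary map away from 0. *)
have [_ [t0 t01 <-]] := ereal_sup_gt sup_gt0.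
have t0r : t0 \in `[- r, 1].
  move: t01; rewrite /= !in_itv/= => /andP[t00 ->]; rewrite andbT.
  by rewrite (le_trans _ t00)// oppr_le0 ltW.
have mdelta := continuous_leb_measurable delta_cont.
have bdelta : bnd delta (supnorm 0 1 delta).
  by apply: leb_ae_true => s; exact: supnorm_ge.
rewrite (opE _ _ _ mdelta bdelta t0r) -EFinD lte_fin => c_gt0.
have Kdelta : K0 (T delta).
  exact (int_opC1_K0 r_gt0 k_ge0 k_meas k_eq0 dk_jump dk_le g_meas g_ge0 gPsi_L1
    mdelta bdelta delta_ge0).
have Kgamma : K0 gamma by split.
have Sb v : K0 v /\ `|v| = rho -> K_boundary psi rho (psi + v).
  by move=> [Kv vr]; exact: K_boundary_sphere.
have Sc v : K0 v /\ `|v| = rho -> K_closure psi rho (psi + v).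
  by move=> [Kv vr]; apply: K_closure_ball => //; rewrite vr.
have [MB BMB] := B_bound.
pose L := `|psi| + rho; have L0 : 0 < L by rewrite ltr_wpDl.
have [M M0 HM] := hist_op_bounded r_gt0 F_ge0 F_cont F_bound L0.
pose h (v : C1 (- r) 1) := hist_op F (psi + v).
have mh v : leb_measurable `[0, 1] (h v) by exact: hist_op_measurable.
have hM v : K0 v /\ `|v| = rho -> bnd (h v) M.
  by move=> [_ vr]; apply: HM; rewrite (le_trans (ler_normD _ _))// vr.
have Bn v : K0 v /\ `|v| = rho -> `|B (psi + v)| <= `|MB|.
  move=> Sv; rewrite ger0_norm; last exact/B_ge0/Sc.
  exact: le_trans (BMB _ (Sc v Sv)) (ler_norm _).
pose N v := T (h v) + B (psi + v) *: gamma.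
(* [e] is [N] with [F] and [B] replaced by their lower bounds, so [e t0] is the positive quantity
   found above and bounds [N v t0] from below on the sphere. *)
pose e := T delta + eta *: gamma.
have eE : e t0 = gamma t0 * eta + int_op k g delta t0.
  by rewrite C1_fctD C1_fctZ (TE _ _ _ mdelta bdelta t0r) addrC mulrC.
pose D (u : C1 (- r) 1) := derive_itv (- r) 1 u.
(* A common modulus for the derivatives of all [N v]: the first term comes from the integral, the
   second from the multiple of [gamma]. *)
pose m t u := M * kernel_modulus r k g t u + `|MB| * `|D gamma t - D gamma u|.
pose Q : set (C1 (- r) 1) := [set u | `|u| <= M * W + `|MB| * `|gamma| /\
  forall s t, s \in `[- r, 1] -> t \in `[- r, 1] -> `|D u s - D u t| <= m s t].
have cptQ : compact Q.
  apply: compact_C1_equicontinuous; first by rewrite (lt_trans _ ltr01)// oppr_lt0.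
  move=> t tr.
  have c1 := kernel_modulus_cvg r_gt0 k_meas k_eq0 dk_jump dk_le g_meas g_ge0 gPsi_L1 tr.
  have [_ /subspace_continuousP/(_ t tr) c2] := C1P gamma.
  have {}c2 : `|D gamma t - D gamma u| @[u --> within `[- r, 1] (nbhs t)] --> 0.
    rewrite -(normr0 R) -(subrr (D gamma t)).
    by apply: cvg_norm; apply: cvgB; [exact: cvg_cst|exact: c2].
  have {c1 c2}H := cvgD (cvgMl_tmp (a := M) c1) (cvgMl_tmp (a := `|MB|) c2).
  by rewrite !mulr0 addr0 in H; exact: H.
have NP v : K0 v /\ `|v| = rho -> [/\ K0 (N v), Q (N v) & e t0 <= N v t0].
  move=> Sv; have hv := hM v Sv; have mv := mh v.
  have B0 : 0 <= B (psi + v) by exact/B_ge0/Sc.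
  split.
  - apply: K0D; last exact: K0Z.
    apply: (int_opC1_K0 r_gt0 k_ge0 k_meas k_eq0 dk_jump dk_le g_meas g_ge0 gPsi_L1 mv hv).
    by move=> s s01; exact: F_ge0.
  - split.
      rewrite (le_trans (ler_normD _ _))// lerD//.
        exact (int_opC1_norm_le r_gt0 k_meas k_eq0 dk_jump dk_le g_meas g_ge0 gPsi_L1 mv hv M0).
      by rewrite normrZ ler_wpM2r// Bn.
    move=> s t sr tr; rewrite /D !C1_deriveD// !C1_deriveZ// opprD addrACA -mulrBr.
    rewrite (le_trans (ler_normD _ _))// lerD//.
      exact (int_opC1_equicontinuous r_gt0 k_meas k_eq0 dk_jump dk_le g_meas g_ge0 gPsi_L1
        mv hv sr tr).
    by rewrite normrM ler_wpM2r// Bn.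
  - rewrite eE C1_fctD C1_fctZ (TE _ _ _ mv hv t0r) addrC lerD//.
      apply: (int_op_le r_gt0 k_ge0 k_meas k_eq0 dk_jump dk_le g_meas g_ge0 gPsi_L1 t0r
        mdelta mv bdelta hv) => s s01.
      by apply: F_ge => //; exact: Sb.
    by rewrite mulrC ler_wpM2r ?gamma_ge0// B_ge//; exact: Sb.
have Ncont : {within [set v | K0 v /\ `|v| = rho], continuous N}.
  apply/subspace_continuousP => v Sv; apply: cvg_within_seq => x Sx xv.
  have psix : psi + x n @[n --> \oo] --> psi + v.
    by apply: cvgD; [exact: cvg_cst|exact: xv].
  apply: cvgD; last first.
    apply: cvgZr_tmp; have /subspace_continuousP/(_ _ (Sc v Sv)) cB := B_cont.
    exact: (within_seq_cvg (f := B) cB (fun n => Sc _ (Sx n)) psix).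
  apply: (int_opC1_cvg r_gt0 k_meas k_eq0 dk_jump dk_le g_meas g_ge0 Psi_L1 gPsi_L1
    (fun n => mh (x n)) (mh v) (fun n => hM _ (Sx n)) (hM v Sv)).
  apply: leb_ae F_cont => s cF s01.
  exact: (@hist_op_cvg _ _ _ r_gt0 s (fun n => psi + x n) (fun=> s) _ s01 (cF s01)
    (fun=> s01) (cvg_cst s) psix).
have ec : 0 < e t0 by rewrite eE.
have Ke : K0 e by apply: K0D => //; exact: K0Z.
(* [e t0] plays two parts here: it is the positive value of the functional at [e] and the lower
   bound [c] on the sphere. *)
have [lambda [v [lambda0 Kv vr vE]]] := @birkhoff_kellogg R _ K0 Q
  (fun v : C1 (- r) 1 => v t0) N e rho (e t0) (@closed_K0 R r) (@K0D R r) (@K0Z R r)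
  rho_gt0 ec cptQ (fun x y => C1_fctD x y t0) (fun a x => C1_fctZ a x t0)
  (fun x => le_trans (ler_norm _) (C1_le_norm x t0r)) Ke ec NP Ncont.
have Sv : K0 v /\ `|v| = rho by [].
exists lambda, (psi + v); split => //; first exact: Sb.
move=> t tr; rewrite (opE _ _ _ (mh v) (hM v Sv) tr) -EFinD; congr EFin.
rewrite C1_fctD [in LHS]vE C1_fctZ C1_fctD C1_fctZ (TE _ _ _ (mh v) (hM v Sv) tr).
by rewrite [B _ * _]mulrC.
Qed.
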